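(* Let $\pi=(d_1,\dots,d_n)$ be a bicyclic degree sequence. Then $B_M(\pi)$ is an extremal graph of $\Gamma(\pi)$, where $B_M(\pi)\in\Gamma(\pi)$ is defined as follows (these four cases exhaust all bicyclic degree sequences): (i) if $d_n=1$ and $d_1\ge d_2\ge 3$, $B_M(\pi)$ is a BFS-graph whose base graph is isomorphic to $K_4$ minus an edge, the remaining vertices appearing in a BFS ordering; (ii) if $d_1\ge 5>d_2=2$ and $d_n=1$, $B_M(\pi)$ is the graph on $n$ vertices obtained from the graph consisting of two triangles sharing exactly one vertex by attaching $d_1-4$ paths of almost equal lengths to that common vertex (of degree four); (iii) if $\pi=(4,2^{(n-1)})$, $B_M(\pi)$ is the graph consisting of two cycles sharing exactly one vertex; (iv) if $\pi=(3^{(2)},2^{(n-2)})$, $B_M(\pi)$ is the graph consisting of a triangle and a cycle sharing exactly one edge.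
   Context: Graphs are finite, simple and connected; $N(v)$ is the neighbor set and $d(v)$ the degree of $v$. $p^{(q)}$ denotes $q$ copies of $p$. A bicyclic graph is a connected graph with $n$ vertices and $n+1$ edges; $\pi$ is a bicyclic degree sequence if it is the non-increasing degree sequence of some bicyclic graph, and $\Gamma(\pi)$ is the set of connected graphs with degree sequence $\pi$. Paths of lengths $l_1,\dots,l_k$ have almost equal lengths if $|l_i-l_j|\le 1$ for all $i,j$. The base graph $\mathcal R(G)$ is obtained from $G$ by repeatedly deleting pendant vertices (degree 1) until none remain. For a graph with distinguished vertex $v_1$, $h(v)$ is the distance from $v$ to $v_1$. $G$ is a BFS-graph if there is an ordering $v_1\prec\cdots\prec v_n$ of $V(G)$ such that (i) $d(v_1)\ge\cdots\ge d(v_n)$ and $h(v_1)\le\cdots\le h(v_n)$; and (ii) whenever $v\in N(u)\setminus N(w)$, $z\in N(w)\setminus N(u)$ with $h(u)=h(w)=h(v)-1=h(z)-1$ and $u\prec w$, then $v\prec z$. For a symmetric function $f(x,y)$ on pairs of positive reals, $M_f(G)=\sum_{uv\in E(G)}f(d(u),d(v))$. $f$ is escalating if $f(x_1,x_2)+f(y_1,y_2)\ge f(x_2,y_1)+f(x_1,y_2)$ for all $x_1\ge y_1>0$, $x_2\ge y_2>0$, strictly whenever $x_1>y_1$ and $x_2>y_2$; de-escalating if the reverse inequality holds for all such values, strictly whenever $x_1>y_1$ and $x_2>y_2$. A fixed escalating or de-escalating $f$ is given; $G$ is an extremal graph of a class $\mathcal G$ if either $f$ is escalating and $M_f(G)=\max_{H\in\mathcal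 G}M_f(H)$, or $f$ is de-escalating and $M_f(G)=\min_{H\in\mathcal G}M_f(H)$.
   Formalization: In case (i) the four vertices of K_4 minus an edge are required to be the first four of the BFS ordering, with the third and fourth non-adjacent; without this a BFS-graph with that base graph need not be extremal, e.g. for (4,4,3,2,1,1,1). *)

(* Defs.v *)
From HB Require Import structures.
From mathcomp Require Import all_boot all_order all_algebra.
From mathcomp Require Import reals.

Set Implicit Arguments.
Unset Strict Implicit.
Unset Printing Implicit Defensive.

Import Order.TTheory GRing.Theory Num.Theory.

Record sgraph := SGraph {
  vertex :> finType;
  adj : rel vertex;
  adj_sym : symmetric adj;
  adj_irrefl : irreflexive adj }.

Arguments adj {s}.

Section Graphs.

Variable G : sgraph.
Implicit Types (u v w x y z : G) (S : {set G}) (s : seq G).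

Definition nbrs v : {set G} := [set u | adj v u].

Definition deg v : nat := #|nbrs v|.

Definition connected : Prop := forall x y, connect (@adj G) x y.

(* Each edge occurs once, as the ordered pair that agrees with the enumeration
   of the vertex type. *)
Definition edges : {set G * G} :=
  [set e | adj e.1 e.2 & enum_rank e.1 < enum_rank e.2].

Definition degree_seq : seq nat := sort geq [seq deg v | v <- enum G].

Definition bicyclic : Prop := connected /\ #|edges| = #|G|.+1.

(* The least length of a walk from x to y; it is #|G| if there is none. *)
Definition dist x y : nat :=
  find (fun k => [exists p : k.-tuple G, path adj x p && (last x p == y)])
       (iota 0 #|G|).

(* One step deletes one vertex that is pendant in the subgraph induced by S.
   #|G| steps suffice to reach a set without pendant vertices. *)
Definition delete_pendant S : {set G} :=
  if [pick v in S | #|nbrs v :&: S| == 1] is Some v then S :\ v else S.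

Definition base_set : {set G} := iter #|G| delete_pendant [set: G].

Definition induced_adj S : rel {x : G | x \in S} :=
  fun (x y : {x : G | x \in S}) => adj (val x) (val y).

Lemma induced_adj_sym S : symmetric (@induced_adj S).
Proof. by move=> x y; apply: adj_sym. Qed.

Lemma induced_adj_irrefl S : irreflexive (@induced_adj S).
Proof. by move=> x; apply: adj_irrefl. Qed.

Definition induced S : sgraph :=
  SGraph (@induced_adj_sym S) (@induced_adj_irrefl S).

Definition base_graph : sgraph := induced base_set.

(* The ordering is v1 :: s, and v precedes z in it when v has smaller index. *)
Definition BFS_ordering (v1 : G) s : Prop :=
  let o := v1 :: s in
  let h := dist v1 in
  let prec u w := index u o < index w o in
  [/\ uniq o /\ (forall v, v \in o),
      sorted (fun u w => deg w <= deg u) o,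
      sorted (fun u w => h u <= h w) o
    & forall u w v z,
        v \in nbrs u :\: nbrs w -> z \in nbrs w :\: nbrs u ->
        h u = h w -> h v = (h u).+1 -> h z = (h u).+1 ->
        prec u w -> prec v z].

Definition BFS_graph : Prop := exists v1 s, BFS_ordering v1 s.

Definition path_edge s x y : bool :=
  ((x, y) \in zip s (behead s)) || ((y, x) \in zip s (behead s)).

Definition cycle_edge s x y : bool :=
  ((x, y) \in zip s (rot 1 s)) || ((y, x) \in zip s (rot 1 s)).

Definition union_of_two_cycles s1 s2 : Prop :=
  [/\ uniq s1 /\ 3 <= size s1,
      uniq s2 /\ 3 <= size s2,
      forall v, (v \in s1) || (v \in s2)
    & forall x y, adj x y = cycle_edge s1 x y || cycle_edge s2 x y].

Definition two_cycles_sharing_vertex : Prop :=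
  exists s1 s2 c, union_of_two_cycles s1 s2 /\
    (forall v, (v \in s1) && (v \in s2) = (v == c)).

Definition triangle_cycle_sharing_edge : Prop :=
  exists s1 s2 a b,
    [/\ union_of_two_cycles s1 s2, size s1 = 3, a != b,
        (forall v, (v \in s1) && (v \in s2) = (v \in [:: a; b]))
      & cycle_edge s1 a b /\ cycle_edge s2 a b].

Definition almost_equal_lengths (ls : seq nat) : Prop :=
  forall l m, l \in ls -> m \in ls -> l <= m.+1.

(* Each p in ps lists the vertices, other than c, of an attached path c :: p,
   whose length is therefore size p. *)
Definition two_triangles_with_paths (k : nat) : Prop :=
  exists (c a1 a2 b1 b2 : G) (ps : seq (seq G)),
    [/\ uniq [:: c, a1, a2, b1, b2 & flatten ps],
        (forall v, v \in [:: c, a1, a2, b1, b2 & flatten ps]),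
        size ps = k /\ [::] \notin ps,
        almost_equal_lengths [seq size p | p <- ps]
      & forall x y, adj x y =
          [|| cycle_edge [:: c; a1; a2] x y, cycle_edge [:: c; b1; b2] x y
            | has (fun p => path_edge (c :: p) x y) ps]].

End Graphs.

Definition isomorphic (G H : sgraph) : Prop :=
  exists2 phi : G -> H, bijective phi & {mono phi : x y / adj x y}.

(* K_4 minus the edge joining 2 and 3. *)
Definition K4e_adj : rel 'I_4 := fun i j => (i != j) && (minn i j < 2).

Lemma K4e_adj_sym : symmetric K4e_adj.
Proof. by move=> i j; rewrite /K4e_adj eq_sym minnC. Qed.

Lemma K4e_adj_irrefl : irreflexive K4e_adj.
Proof. by move=> i; rewrite /K4e_adj eqxx. Qed.

Definition K4e : sgraph := SGraph K4e_adj_sym K4e_adj_irrefl.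

Definition bicyclic_degree_seq (pi : seq nat) : Prop :=
  exists2 G : sgraph, bicyclic G & degree_seq G = pi.

Definition Gamma (pi : seq nat) (G : sgraph) : Prop :=
  connected G /\ degree_seq G = pi.

(* The vertices of K_4 - e come first in the BFS ordering, as v1, v2, v3, v4
   with triangles v1 v2 v3 and v1 v2 v4, and the others follow. This placement
   is needed: a BFS-graph with base graph K_4 - e need not be extremal. For
   (3,3,3,3,2,1,1), the graph with edges 12, 13, 14, 23, 25, 35, 46, 47 is
   such a BFS-graph, but its base set is {1,2,3,5} and it is not extremal. For
   (4,4,3,2,1,1,1), neither is the one with edges 12, 13, 14, 15, 23, 34, 26,
   27, in which the first four vertices induce K_4 minus the edge 24. *)
Definition BFS_graph_on_K4e (G : sgraph) : Prop :=
  [/\ BFS_graph G, isomorphic (base_graph G) K4e &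
  exists v1 v2 v3 v4 (s : seq G),
    [/\ BFS_ordering v1 [:: v2, v3, v4 & s],
        base_set G = [set v1; v2; v3; v4] & ~~ adj v3 v4]].

(* G is a graph B_M(pi). *)
Definition is_BM (pi : seq nat) (G : sgraph) : Prop :=
  let n := size pi in
  let d1 := nth 0 pi 0 in
  let d2 := nth 0 pi 1 in
  let dn := last 0 pi in
  [\/ [/\ dn = 1, 3 <= d2 <= d1, Gamma pi G & BFS_graph_on_K4e G],
      [/\ 5 <= d1, d2 = 2, dn = 1, #|G| = n
        & two_triangles_with_paths G (d1 - 4)],
      [/\ pi = 4 :: nseq (n - 1) 2, #|G| = n & two_cycles_sharing_vertex G]
    | [/\ pi = [:: 3, 3 & nseq (n - 2) 2], #|G| = n
        & triangle_cycle_sharing_edge G]].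

Section Invariant.

Variables (R : realType) (f : R -> R -> R).
Local Open Scope ring_scope.

Definition symmetric_on_pos : Prop :=
  forall x y, 0 < x -> 0 < y -> f x y = f y x.

Definition escalating : Prop :=
  forall x1 x2 y1 y2, 0 < y1 -> y1 <= x1 -> 0 < y2 -> y2 <= x2 ->
    f x1 x2 + f y1 y2 >= f x2 y1 + f x1 y2 /\
    (x1 > y1 -> x2 > y2 -> f x1 x2 + f y1 y2 > f x2 y1 + f x1 y2).

Definition deescalating : Prop :=
  forall x1 x2 y1 y2, 0 < y1 -> y1 <= x1 -> 0 < y2 -> y2 <= x2 ->
    f x1 x2 + f y1 y2 <= f x2 y1 + f x1 y2 /\
    (x1 > y1 -> x2 > y2 -> f x1 x2 + f y1 y2 < f x2 y1 + f x1 y2).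

Definition Mf (G : sgraph) : R :=
  \sum_(e in edges G) f (deg e.1)%:R (deg e.2)%:R.

Definition extremal (C : sgraph -> Prop) (G : sgraph) : Prop :=
  C G /\
  ((escalating /\ forall H, C H -> Mf H <= Mf G) \/
   (deescalating /\ forall H, C H -> Mf G <= Mf H)).

End Invariant.

(* Main.v *)
Require Import Defs.
From mathcomp Require Import all_boot all_order all_algebra.
From mathcomp Require Import reals.
From mathcomp Require Import zify ring lra.

Set Implicit Arguments.
Unset Strict Implicit.
Unset Printing Implicit Defensive.

Import Order.TTheory GRing.Theory Num.Theory.

(** Summation by parts writes [2 * M_f] as a function of the degree sequence
    plus the sum over thresholds [a, b >= 1] of the mixed second difference of
    [f] times the number of ordered adjacent pairs [(x, y)] with [deg x > a]
    and [deg y > b]. For escalating [f] these coefficients are nonnegative, so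
    it suffices that [B_M(pi)] maximizes all these counts simultaneously.

    Let [A] and [B], [A] inside [B], be the sets of vertices of degree above [a]
    and above [b]. In a connected graph with [n + 1] edges, the count for
    [(A, B)] is at most the degree sum of [A], at most [e(A) + e(B)], where
    [e(S) <= min (|S| (|S| - 1) / 2, |S| + 1)] is the number of edges inside
    [S], and at most [|B| - 1] when [A] is a singleton. In [B_M(pi)] one of
    these bounds is attained: in a BFS-graph [A] and [B] are initial segments
    of the ordering, and if a vertex of [A] has a neighbour outside [B], then
    the BFS condition leaves no edge inside [B \ A]. *)

(** * Degree thresholds and the invariant *)

(** A competitor in [Gamma pi] is known only through its degree sequence, so each upper bound has to
    be a function of [pi]. The degree sum of [A], [|A|] and [|B|] are such functions; attaining one
    of the bounds is therefore a property of [B_M(pi)] alone, and no two graphs are compared by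
    switching edges. The bound [e(A) + e(B)] comes from an identity whose defect is the count inside
    [B \ A]; this is why the absence of edges there is the decisive point. The edge budget supplies
    the structure. In a BFS ordering that starts with [K_4 - e], the BFS parents and one further
    earlier neighbour of the third and of the fourth vertex account for all [n + 1] edges, so
    nothing else can point backwards. Existence rests on the same budget: the degrees prescribe how
    many children each vertex has, and handing the children out in order makes the parent map
    monotone, which is what the BFS condition amounts to. *)

Section Counting.

Variable G : sgraph.
Implicit Types (A B S : {set G}) (x y v : G).

(** Ordered pairs are counted, so an edge inside [A :&: B] counts twice; this makes the count
    symmetric and additive in each argument. *)
Definition ecount A B : nat := \sum_(x in A) #|nbrs x :&: B|.

Definition above (a : nat) : {set G} := [set v | a < deg v].

Lemma ecountE A B : ecount A B = \sum_(x in A) \sum_(y in B) adj x y.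
Proof.
apply: eq_bigr => x _; rewrite -sum1_card.
rewrite (eq_bigl (fun y => (y \in B) && adj x y)); last first.
  by move=> y; rewrite !inE andbC.
by rewrite big_mkcondr; apply: eq_bigr => y _; case: (adj x y).
Qed.

Lemma ecountC A B : ecount A B = ecount B A.
Proof.
rewrite !ecountE exchange_big; apply: eq_bigr => x _; apply: eq_bigr => y _.
by rewrite adj_sym.
Qed.

Lemma ecountTr A : ecount A setT = \sum_(x in A) deg x.
Proof. by apply: eq_bigr => x _; rewrite setIT. Qed.

Lemma ecountTT : ecount setT setT = \sum_(x : G) deg x.
Proof. by rewrite ecountTr; apply: eq_bigl => x; rewrite inE. Qed.

Lemma ecountIDr S A B : ecount A B = ecount A (B :&: S) + ecount A (B :\: S).
Proof.
rewrite !ecountE -big_split; apply: eq_bigr => x _ /=.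
by rewrite (big_setID S).
Qed.

Lemma ecountIDl S A B : ecount A B = ecount (A :&: S) B + ecount (A :\: S) B.
Proof. by rewrite !(ecountC _ B) -ecountIDr. Qed.

(** With [C = B :\: A], both sides equal 2 e(A,A) + 2 e(A,C) + e(C,C). Bounding [ecount A B] by the
    counts inside [A] and inside [B] thus loses only the pairs inside [C]. *)
Lemma ecount_subset A B : A \subset B ->
  2 * ecount A B + ecount (B :\: A) (B :\: A) = ecount A A + ecount B B.
Proof.
move=> sAB; have BA : B :&: A = A by apply/setIidPr.
rewrite (ecountIDl A B B) (ecountIDr A (B :\: A) B) BA.
rewrite (ecountIDr A A B) BA (ecountC (B :\: A) A); lia.
Qed.

Lemma ecount_deg A B : ecount A B <= \sum_(x in A) deg x.
Proof. by apply: leq_sum => x _; apply/subset_leq_card/subsetIl. Qed.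

Lemma card_nbrsI x B : x \in B -> #|nbrs x :&: B| <= #|B|.-1.
Proof.
move=> xB; have := cardsD1 x B; rewrite xB add1n => -> /=.
apply/subset_leq_card/subsetP => y; rewrite !inE => /andP[xy ->].
by rewrite andbT; apply: contraTneq xy => ->; rewrite adj_irrefl.
Qed.

Lemma ecount_complete A B : A \subset B -> ecount A B <= #|A| * #|B|.-1.
Proof.
move=> /subsetP sAB; rewrite -sum_nat_const; apply: leq_sum => x /sAB.
exact: card_nbrsI.
Qed.

Lemma above_subset a b : b <= a -> above a \subset above b.
Proof. by move=> ba; apply/subsetP => x; rewrite !inE; apply: leq_ltn_trans. Qed.

(* Counting an adjacency by its endpoint of larger rank. *)
Lemma ecount_rank (r : G -> nat) S : injective r ->
  ecount S S = 2 * \sum_(x in S) #|[set y in nbrs x :&: S | r y < r x]|.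
Proof.
move=> r_inj.
have lowE x : #|[set y in nbrs x :&: S | r y < r x]| =
    \sum_(y in S) adj x y * (r y < r x).
  rewrite -sum1_card.
  rewrite (eq_bigl (fun y => (y \in S) && (adj x y && (r y < r x)))); last first.
    by move=> y; rewrite !inE; case: adj; case: (y \in S).
  rewrite big_mkcondr; apply: eq_bigr => y _.
  by case: (adj x y); case: (r y < r x).
under eq_bigr do rewrite lowE.
rewrite mul2n -addnn {2}exchange_big -big_split ecountE.
apply: eq_bigr => x _; rewrite -big_split; apply: eq_bigr => y _ /=.
rewrite (adj_sym y x); case xy: (adj x y) => //=.
by case: ltngtP => // /r_inj E; rewrite E adj_irrefl in xy.
Qed.

Lemma sum_deg : \sum_(x : G) deg x = 2 * #|edges G|.
Proof.
rewrite -ecountTT (@ecount_rank (fun x => enum_rank x)); last first.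
  by move=> x y /ord_inj /enum_rank_inj.
congr (_ * _).
have -> : #|edges G| = \sum_(x : G)
    \sum_(y : G | adj x y && (enum_rank x < enum_rank y)) 1.
  by rewrite -sum1_card pair_big_dep; apply: eq_bigl => e; rewrite inE.
rewrite (exchange_big_dep predT) //=.
apply: eq_big => [x|x _]; first by rewrite inE.
by rewrite -sum1_card; apply: eq_bigl => y; rewrite !inE andbT adj_sym.
Qed.

End Counting.

Section DegreeInvariance.

Variables (T : Type) (idx : T) (op : Monoid.com_law idx).

Lemma big_degs (G : sgraph) (P : pred nat) (F : nat -> T) :
  \big[op/idx]_(v : G | P (deg v)) F (deg v)
  = \big[op/idx]_(d <- degree_seq G | P d) F d.
Proof.
by rewrite (perm_big _ (permEl (perm_sort _ _))) big_map big_enum_cond.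
Qed.

End DegreeInvariance.

Lemma size_degree_seq (G : sgraph) : size (degree_seq G) = #|G|.
Proof. by rewrite size_sort size_map cardE. Qed.

Lemma sumn_degree_seq (G : sgraph) : sumn (degree_seq G) = \sum_(x : G) deg x.
Proof. by rewrite sumnE -(@big_degs _ _ _ G predT id). Qed.

Lemma card_above (G : sgraph) a :
  #|above G a| = count (fun d => a < d) (degree_seq G).
Proof.
rewrite -sum1_card -sum1_count -(@big_degs _ _ _ _ (fun d => a < d) (fun=> 1)).
by apply: eq_bigl => x; rewrite inE.
Qed.

Lemma sum_deg_above (G : sgraph) a :
  \sum_(x in above G a) deg x = \sum_(d <- degree_seq G | a < d) d.
Proof.
by rewrite -(@big_degs _ _ _ _ (fun d => a < d) id); apply: eq_bigl => x; rewrite inE.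
Qed.

(** * Summation by parts over degree thresholds *)

Section Decomposition.

Variables (R : realType) (f : R -> R -> R).
Local Open Scope ring_scope.
Hypothesis f_sym : symmetric_on_pos f.

Let F (x y : nat) : R := f x%:R y%:R.

Definition mixed_diff (a b : nat) : R := F a.+1 b.+1 - F a b.+1 - F a.+1 b + F a b.

Lemma mixed_diff_ge0 a b : escalating f -> (0 < a)%N -> (0 < b)%N ->
  0 <= mixed_diff a b.
Proof.
move=> f_esc a0 b0.
have [] := f_esc a.+1%:R b.+1%:R a%:R b%:R; rewrite ?ltr0n ?ler_nat //.
rewrite -/(F a.+1 b.+1) -/(F a b) -/(F b.+1 a) -/(F a.+1 b) => + _.
have -> : F b.+1 a = F a b.+1 by apply: f_sym; rewrite ltr0n.
rewrite /mixed_diff; lra.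
Qed.

(** Telescoping in both variables from 1. Thresholds start at 1 because [f] is constrained only on
    positive arguments; the common upper end [N] makes the index range independent of [x] and [y],
    so that it can be exchanged with sums over vertices. *)
Lemma mixed_diff_sum (N x y : nat) : (0 < x <= N)%N -> (0 < y <= N)%N ->
  F x y = F x 1%N + F 1%N y - F 1%N 1%N +
    \sum_(1 <= a < N) \sum_(1 <= b < N) mixed_diff a b *+ ((a < x) && (b < y))%N.
Proof.
move=> /andP[x0 xN] /andP[y0 yN].
have trunc (g : nat -> R) z : (0 < z <= N)%N ->
    \sum_(1 <= a < N) g a *+ (a < z)%N = \sum_(1 <= a < z) g a.
  move=> /andP[z0 zN]; rewrite (big_cat_nat z0 zN) /=.
  rewrite [X in _ + X](_ : _ = 0) ?addr0; last first.
    rewrite big_nat big1 // => i /andP[zi _].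
    by rewrite ltnNge zi mulr0n.
  by apply: eq_big_nat => i /andP[_ ->]; rewrite mulr1n.
have -> : \sum_(1 <= a < N) \sum_(1 <= b < N)
      mixed_diff a b *+ ((a < x) && (b < y))%N
    = \sum_(1 <= a < x) \sum_(1 <= b < y) mixed_diff a b.
  rewrite -[RHS](trunc (fun a => \sum_(1 <= b < y) mixed_diff a b)) ?x0 //.
  apply: eq_bigr => a _; rewrite -(trunc (mixed_diff a)) ?y0 // -sumrMnl.
  apply: eq_bigr => b _.
  by rewrite -mulrnA mulnb andbC.
have -> : \sum_(1 <= a < x) \sum_(1 <= b < y) mixed_diff a b =
   \sum_(1 <= a < x) ((F a.+1 y - F a.+1 1%N) - (F a y - F a 1%N)).
  apply: eq_bigr => a _.
  rewrite -!(telescope_sumr _ y0) -sumrB; apply: eq_bigr => b _.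
  rewrite /mixed_diff; ring.
rewrite (telescope_sumr (fun a => F a y - F a 1%N) x0); ring.
Qed.

Lemma Mf_ordered (G : sgraph) :
  Mf f G *+ 2 = \sum_(x : G) \sum_(y : G | adj x y) F (deg x) (deg y).
Proof.
have F_sym (x y : G) : adj x y -> F (deg x) (deg y) = F (deg y) (deg x).
  move=> xy; apply: f_sym; rewrite ltr0n card_gt0; apply/set0Pn.
    by exists y; rewrite inE.
  by exists x; rewrite inE adj_sym.
have half : Mf f G = \sum_(x : G)
    \sum_(y : G | adj x y && (enum_rank x < enum_rank y)%N) F (deg x) (deg y).
  rewrite /Mf pair_big_dep /=; apply: eq_bigl => e; by rewrite inE.
rewrite mulr2n {2}half (exchange_big_dep predT) //= half -big_split /=.
apply: eq_bigr => x _.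
rewrite [RHS](bigID (fun y => (enum_rank x < enum_rank y)%N)) /=; congr (_ + _).
apply: eq_big => [y|y /andP[yx _]]; last exact: F_sym.
rewrite (adj_sym y x); case xy: (adj x y) => //=.
rewrite -leqNgt ltn_neqAle; case: eqP => //= /ord_inj /enum_rank_inj E.
by rewrite E adj_irrefl in xy.
Qed.

(** A vertex of degree [d] is the first entry of [d] ordered adjacent pairs and the second entry of
    as many, so it collects both boundary terms [d] times; the constant is charged to the first
    entry. *)
Definition degree_part (d : nat) : R := (F d 1%N + F 1%N d - F 1%N 1%N) *+ d.

Lemma Mf_decomp (G : sgraph) :
  Mf f G *+ 2 = \sum_(d <- degree_seq G) degree_part d +
    \sum_(1 <= a < #|G|) \sum_(1 <= b < #|G|)
       mixed_diff a b *+ ecount (above G a) (above G b).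
Proof.
have deg_bounds (x y : G) : adj x y -> (0 < deg x <= #|G|)%N.
  move=> xy; rewrite max_card andbT card_gt0.
  by apply/set0Pn; exists y; rewrite inE.
rewrite Mf_ordered.
have expand (x y : G) : adj x y -> F (deg x) (deg y) = _ :=
  fun xy => mixed_diff_sum (deg_bounds x y xy)
    (deg_bounds y x (etrans (adj_sym y x) xy)).
under eq_bigr => x _ do under eq_bigr => y xy do rewrite (expand _ _ xy).
under eq_bigr do rewrite big_split /=.
rewrite big_split /=; congr (_ + _).
  have const_sum (g : nat -> R) (x : G) :
      \sum_(y | adj x y) g (deg x) = g (deg x) *+ deg x.
    by rewrite sumr_const; congr (_ *+ _); apply: eq_card => y; rewrite inE.
  under eq_bigr do rewrite big_split big_split /=.
  (* The term in [deg y] is charged to [y] by exchanging the order of summation. *)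
  rewrite 2!big_split /= [X in _ + X + _](exchange_big_dep predT) //=.
  rewrite -(@big_degs _ _ _ G predT) -!big_split /=.
  apply: eq_bigr => x _.
  rewrite (const_sum (fun d => F d 1%N)) (const_sum (fun=> - F 1%N 1%N)).
  rewrite (eq_bigl (fun y => adj x y)); last by move=> y; rewrite adj_sym.
  by rewrite (const_sum (fun d => F 1%N d)) /degree_part !mulrnDl.
have swap (x : G) : \sum_(y | adj x y) \sum_(1 <= a < #|G|)
    \sum_(1 <= b < #|G|) mixed_diff a b *+ ((a < deg x) && (b < deg y))%N =
   \sum_(1 <= a < #|G|) \sum_(1 <= b < #|G|)
    \sum_(y | adj x y) mixed_diff a b *+ ((a < deg x) && (b < deg y))%N.
  by rewrite exchange_big; apply: eq_bigr => a _; rewrite exchange_big.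
under eq_bigr do rewrite swap.
rewrite exchange_big; apply: eq_bigr => a _ /=.
rewrite exchange_big; apply: eq_bigr => b _ /=.
under eq_bigr do rewrite sumrMnr.
rewrite sumrMnr ecountE; congr (_ *+ _); rewrite [RHS]big_mkcond.
apply: eq_bigr => x _.
rewrite inE; case: (a < deg x)%N => /=; last by rewrite big1.
rewrite big_mkcond [RHS]big_mkcond /=; apply: eq_bigr => y _.
by rewrite inE; case: adj; case: (b < deg y)%N.
Qed.

End Decomposition.

(** * Comparing two graphs with the same degrees *)

Definition dominates (G H : sgraph) : Prop := forall a b, 1 <= b -> b <= a ->
  ecount (above H a) (above H b) <= ecount (above G a) (above G b).

Section Dominance.

Variables (R : realType) (G H : sgraph).
Hypotheses (degGH : degree_seq G = degree_seq H) (domGH : dominates G H).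
Local Open Scope ring_scope.

Lemma Mf_dominates (f : R -> R -> R) :
  symmetric_on_pos f -> escalating f -> Mf f H <= Mf f G.
Proof.
move=> f_sym f_esc; rewrite -(@ler_pMn2r _ 2) // !Mf_decomp // degGH lerD2l.
rewrite -!size_degree_seq degGH !size_degree_seq.
rewrite big_nat [leRHS]big_nat; apply: ler_sum => a /andP[a1 _].
rewrite big_nat [leRHS]big_nat; apply: ler_sum => b /andP[b1 _].
apply: ler_wpMn2l; first exact: mixed_diff_ge0.
have [ba|/ltnW ab] := leqP b a; first exact: domGH.
by rewrite ecountC [leqRHS]ecountC; apply: domGH.
Qed.

Lemma Mf_dominates_de (f : R -> R -> R) :
  symmetric_on_pos f -> deescalating f -> Mf f G <= Mf f H.
Proof.
move=> f_sym f_de; rewrite -lerN2 /Mf -!sumrN.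
apply: (@Mf_dominates (fun x y => - f x y)).
  by move=> x y x0 y0; rewrite f_sym.
move=> x1 x2 y1 y2 h1 h2 h3 h4; have [le1 lt1] := f_de _ _ _ _ h1 h2 h3 h4.
by split=> [|h5 h6]; [|have := lt1 h5 h6]; lra.
Qed.

End Dominance.

Lemma extremal_dominates (R : realType) (f : R -> R -> R) pi (G : sgraph) :
  symmetric_on_pos f -> escalating f \/ deescalating f -> Gamma pi G ->
  (forall H, Gamma pi H -> dominates G H) -> extremal f (Gamma pi) G.
Proof.
move=> f_sym f_esc GG dom; split=> //.
have degE H : Gamma pi H -> degree_seq G = degree_seq H.
  by case: GG => _ ->; case=> _ ->.
case: f_esc => f_esc; [left|right]; split=> // H HH.
  by apply: Mf_dominates => //; [exact: degE | exact: dom].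
by apply: Mf_dominates_de => //; [exact: degE | exact: dom].
Qed.

(** * Distances and bounds for bicyclic graphs *)

Section Distance.

Variable G : sgraph.
Implicit Types (x y z : G) (p : seq G).

Lemma dist_le_size x p : path adj x p -> dist x (last x p) <= size p.
Proof.
(* [#|G|] is the default value of [dist] and its maximum, so long walks satisfy the bound
   trivially. *)
move=> xp; have [ltp|lep] := ltnP (size p) #|G|; last first.
  by apply: leq_trans lep; rewrite -[leqRHS](size_iota 0) find_size.
rewrite leqNgt; apply/negP => /(before_find 0).
rewrite nth_iota // => /existsP[]; exists (in_tuple p) => /=.
by rewrite xp eqxx.
Qed.

Lemma dist_path x y : connect adj x y ->
  exists p, [/\ path adj x p, last x p = y & size p = dist x y].
Proof.
case/connectP=> p0 /shortenP[p xp Up _ ->].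
set P := (fun k => [exists p1 : k.-tuple G, path adj x p1 &&
  (last x p1 == last x p)]).
(* A simple path has fewer than [#|G|] edges, so the bounded search in [dist] succeeds. *)
have ltp : size p < #|G|.
  by have := max_card (mem (x :: p)); rewrite (card_uniqP Up).
have hasP : has P (iota 0 #|G|).
  apply/hasP; exists (size p); first by rewrite mem_iota.
  by apply/existsP; exists (in_tuple p); rewrite /= xp eqxx.
have := nth_find 0 hasP; rewrite nth_iota; last first.
  by move: hasP; rewrite has_find size_iota.
case/existsP=> q /andP[xq /eqP lq]; exists q; split=> //.
by rewrite size_tuple.
Qed.

Lemma dist0 x : dist x x = 0.
Proof. by apply/eqP; rewrite -leqn0; apply: (@dist_le_size x [::]). Qed.

Lemma dist_eq0 x y : connect adj x y -> dist x y = 0 -> x = y.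
Proof. by case/dist_path=> -[|z p] [] //= _ _ <-. Qed.

Lemma dist_adj x y z : connect adj x y -> adj y z -> dist x z <= (dist x y).+1.
Proof.
case/dist_path=> p [xp lp <-] yz.
have := @dist_le_size x (rcons p z); rewrite last_rcons size_rcons; apply.
by rewrite rcons_path xp lp.
Qed.

Lemma dist_pred x y : connect adj x y -> 0 < dist x y ->
  exists2 z, adj y z & dist x y = (dist x z).+1.
Proof.
move=> xy; case: (dist_path xy) => p; case/lastP: p => [|p z]; case.
  by move=> _ _ <-.
rewrite rcons_path last_rcons size_rcons => /andP[xp pz] <- E _.
exists (last x p); first by rewrite adj_sym.
apply/eqP; rewrite eqn_leq -{2}E ltnS dist_le_size // andbT.
by apply: dist_adj pz; apply/connectP; exists p.
Qed.

(** A certificate for distances: descending along [h] gives a walk of length [h y] from [x], and the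
    growth condition forbids a shorter one. The constructed BFS-graph gets its levels and its
    connectedness from it. *)
Lemma dist_unique (h : G -> nat) x y :
    h x = 0 -> (forall u v, adj u v -> h v <= (h u).+1) ->
    (forall u, u != x -> exists2 v, adj u v & h u = (h v).+1) ->
  dist x y = h y /\ connect adj x y.
Proof.
move=> hx h_adj h_pred.
have reach k : forall z, h z = k ->
    exists p, [/\ path adj x p, last x p = z & size p = k].
  elim: k => [|k IHk] z hz.
    exists [::]; split=> //=; apply/esym/eqP/negPn/negP => /h_pred[v _].
    by rewrite hz.
  have [|v zv] := h_pred z; first by apply: contra_eq_neq hz => ->; rewrite hx.
  rewrite hz => -[/esym /IHk[p [xp lp sp]]].
  exists (rcons p z); rewrite last_rcons size_rcons rcons_path xp sp lp.
  by rewrite adj_sym zv.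
have [p [xp lp sp]] := reach _ y erefl.
have cxy : connect adj x y by apply/connectP; exists p.
split=> //; apply/eqP; rewrite eqn_leq; apply/andP; split.
  by rewrite -sp -[X in dist x X]lp dist_le_size.
case: (dist_path cxy) => q [xq lq <-]; rewrite -lq.
elim/last_ind: q xq {lq} => [|q z IHq]; first by rewrite /= hx.
rewrite rcons_path last_rcons size_rcons => /andP[/IHq hq /h_adj hz].
exact: leq_trans hz _.
Qed.

End Distance.

(* The most adjacent ordered pairs that k vertices of a bicyclic graph can span. *)
Definition max_pairs (k : nat) : nat := minn (k * k.-1) (2 * k.+1).

Section BicyclicBounds.

Variable G : sgraph.
Implicit Types (A B S : {set G}).

Lemma connected_parents (r : G) : connected G ->
  exists p : G -> G, forall x, x != r ->
    adj x (p x) /\ dist r x = (dist r (p x)).+1.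
Proof.
move=> cG; exists (fun x =>
  odflt x [pick y | adj x y && (dist r x == (dist r y).+1)]) => x xr.
case: pickP => [y /andP[xy /eqP]//|no].
have [|y xy E] := dist_pred (cG r x).
  by rewrite lt0n; apply: contra_neq xr => /(dist_eq0 (cG r x)).
by have := no y; rewrite xy E eqxx.
Qed.

Hypotheses (cG : connected G) (degG : \sum_(x : G) deg x = 2 * #|G|.+1).

(* Rooting G in S, each vertex outside S contributes the edge to its parent. *)
Lemma ecount_bicyclic S : ecount S S <= max_pairs #|S|.
Proof.
rewrite leq_min ecount_complete //=.
have [->|[r rS]] := set_0Vmem S; first by rewrite /ecount big_set0.
have [p pP] := connected_parents r cG.
have outE x : x \notin S -> x != r by apply: contraNneq => ->.
have total : \sum_(x : G) \sum_(y : G) adj x y = 2 * #|G|.+1.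
  rewrite -degG; apply: eq_bigr => x _; rewrite /deg -sum1_card big_mkcond.
  by rewrite [RHS]big_mkcond; apply: eq_bigr => y _; rewrite inE; case: adj.
have inS : ecount S S = \sum_(x : G) \sum_(y : G)
    ((x \in S) && (y \in S) && adj x y).
  rewrite ecountE big_mkcond; apply: eq_bigr => x _.
  case: (x \in S) => /=; last by rewrite big1.
  by rewrite big_mkcond; apply: eq_bigr => y _; case: (y \in S).
have out1 : \sum_(x : G) \sum_(y : G) ((x \notin S) && (y == p x)) = #|~: S|.
  rewrite -sum1_card big_mkcond [RHS]big_mkcond; apply: eq_bigr => x _ /=.
  rewrite inE; case: (x \notin S) => /=; last by rewrite big1.
  by rewrite (bigD1 (p x)) //= eqxx big1 // => y /negPf->.
have out2 : \sum_(x : G) \sum_(y : G) ((y \notin S) && (x == p y)) = #|~: S|.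
  by rewrite exchange_big out1.
(* Three families of adjacent ordered pairs: those inside [S], and the edge from each vertex outside
   [S] to its parent, in both directions. They are disjoint since two vertices cannot be parents of
   each other. *)
have : \sum_(x : G) \sum_(y : G) (((x \in S) && (y \in S) && adj x y) +
    ((x \notin S) && (y == p x)) + ((y \notin S) && (x == p y))) <=
    \sum_(x : G) \sum_(y : G) adj x y.
  apply: leq_sum => x _; apply: leq_sum => y _.
  case xS: (x \in S); case yS: (y \in S) => //=; rewrite ?addn0 ?add0n //.
  - case: eqP => // ->; have [] := pP y; first by rewrite outE ?yS.
    by rewrite adj_sym => ->.
  - case: eqP => // ->; have [] := pP x; first by rewrite outE ?xS.
    by move=> ->.
  have [] := pP x; first by rewrite outE ?xS.
  have [] := pP y; first by rewrite outE ?yS.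
  case: (y =P p x) => [E|_]; case: (x =P p y) => [E'|_] //=.
  - by rewrite -E -E' => _ -> _ /eqP; rewrite -addn2 -[X in X == _]addn0 eqn_add2l.
  - by rewrite -E => _ _ ->.
  - by rewrite adj_sym -E' => ->.
under eq_bigr do rewrite !big_split /=.
rewrite !big_split /= -inS out1 out2 total.
by have := cardsC S; lia.
Qed.

Lemma ecount_bicyclic2 A B : A \subset B ->
  2 * ecount A B <= max_pairs #|A| + max_pairs #|B|.
Proof.
move=> /ecount_subset; have := ecount_bicyclic A; have := ecount_bicyclic B; lia.
Qed.

(** Discarding the vertices of degree at most one loses at most one edge for each, so the [m]
    remaining vertices keep at least [m + 1] edges. *)
Lemma ecount_above1 : 2 * #|above G 1|.+1 <= ecount (above G 1) (above G 1).
Proof.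
set D := above G 1.
have leaves : \sum_(x in ~: D) deg x <= #|~: D|.
  rewrite -sum1_card; apply: leq_sum => x; rewrite !inE; lia.
have := degG; rewrite (bigID (mem D)) /= -!/(D).
have -> : \sum_(i | i \notin D) deg i = \sum_(x in ~: D) deg x.
  by apply: eq_bigl => x; rewrite in_setC.
have -> : \sum_(x in D) deg x = ecount D D + ecount D (~: D).
  by rewrite -ecountTr (ecountIDr D) setTI setTD.
have := ecount_deg (~: D) D; rewrite (ecountC (~: D)).
have : #|D| + #|~: D| = #|G| by rewrite cardsC.
move: leaves; move: #|D| #|~: D| #|G| => d k n; lia.
Qed.

(** When [m] vertices span at least [m + 1] edges, [2 * (m + 1) <= m * (m - 1)], which fails for
    [m <= 3]. *)
Lemma card_above1_ge4 : 4 <= #|above G 1|.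
Proof.
have := leq_trans ecount_above1 (ecount_bicyclic _).
rewrite /max_pairs; move: #|_| => m; rewrite leq_min leqnn andbT.
by case: m => [|[|[|[|]]]].
Qed.

End BicyclicBounds.

(** Each alternative attains a bound that the degree sequence determines. The third is there because
    [max_pairs 1 = 0] leaves the second bound at half of [max_pairs #|B|], which exceeds the
    [#|B| - 1] possible neighbours as soon as [#|B| >= 3]. *)
Definition tight (G : sgraph) : Prop := forall a b, 1 <= b -> b <= a ->
  let A := above G a in let B := above G b in
  [\/ \sum_(x in A) deg x <= ecount A B,
      max_pairs #|A| + max_pairs #|B| <= 2 * ecount A B
    | #|A| <= 1 /\ #|B|.-1 <= ecount A B].

Lemma tight_dominates (G H : sgraph) :
    connected H -> \sum_(x : H) deg x = 2 * #|H|.+1 ->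
    degree_seq G = degree_seq H -> tight G ->
  dominates G H.
Proof.
move=> cH sH degE tG a b b1 ba; have := tG a b b1 ba => /=.
rewrite sum_deg_above !card_above degE -(sum_deg_above H) -!(card_above H).
have sAB := above_subset H ba.
case=> [le1|le1|[A1 le1]].
- exact: leq_trans (ecount_deg _ _) le1.
- by have := ecount_bicyclic2 cH sH sAB; lia.
- apply: leq_trans (ecount_complete sAB) (leq_trans _ le1).
  by move: A1; case: #|above H a| => [|[]] // _; rewrite mul1n.
Qed.

(** * BFS-graphs on a K4 minus an edge *)

Section BFSTight.

Variables (G : sgraph) (v1 v2 v3 v4 : G) (s : seq G).
Let o := [:: v1, v2, v3, v4 & s].
Let idx (x : G) := index x o.
Let h := dist v1.
Implicit Types (x y z : G) (S : {set G}).

Hypotheses (cG : connected G) (degG : \sum_(x : G) deg x = 2 * #|G|.+1).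
Hypothesis bfs : BFS_ordering v1 [:: v2, v3, v4 & s].
Hypotheses (a12 : adj v1 v2) (a13 : adj v1 v3) (a14 : adj v1 v4).
Hypotheses (a23 : adj v2 v3) (a24 : adj v2 v4) (na34 : ~~ adj v3 v4).

Let o_uniq : uniq o. Proof. by case: bfs => -[]. Qed.
Let o_mem x : x \in o. Proof. by case: bfs => -[]. Qed.

Let idx_inj : injective idx.
Proof. by move=> x y E; rewrite -(nth_index v1 (o_mem x)) -/(idx x) E nth_index. Qed.

Let idx_v : [/\ idx v1 = 0, idx v2 = 1, idx v3 = 2 & idx v4 = 3].
Proof.
by split; rewrite -[RHS](@index_uniq _ v1 _ o).
Qed.

Let deg_idx x y : idx x <= idx y -> deg y <= deg x.
Proof.
case: bfs => _ so _ _.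
apply: (@sorted_leq_index _ (fun u w => deg w <= deg u)) => //.
by move=> u v w /= uv vw; apply: leq_trans uv.
Qed.

Let h_idx x y : idx x <= idx y -> h x <= h y.
Proof.
case: bfs => _ _ so _.
apply: (@sorted_leq_index _ (fun u w => h u <= h w)) => //.
by move=> u v w /= uv vw; apply: leq_trans vw.
Qed.

Let h_lt_idx x y : h x < h y -> idx x < idx y.
Proof. by move=> hxy; rewrite ltnNge; apply: contraL hxy => /h_idx; rewrite -leqNgt. Qed.

Let parentP x : x != v1 -> exists2 y, adj x y & h x = (h y).+1.
Proof.
have [p pP] := connected_parents v1 cG.
by move=> /pP[]; exists (p x).
Qed.

Let low x : {set G} := [set y in nbrs x | idx y < idx x].

(** The earlier neighbours known to exist: a parent one level closer to [v1], and for [v3] and [v4]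
    both [v1] and [v2]. *)
Let low_bound x : nat := (x != v1) + (x \in [:: v3; v4]).

Let low_bound_le x : low_bound x <= #|low x|.
Proof.
have [i1 i2 i3 i4] := idx_v.
have two x' : adj v1 x' -> adj v2 x' -> 1 < idx x' -> 2 <= #|low x'|.
  move=> a1 a2 lt1; apply: (@leq_trans #|[set v1; v2]|).
    by rewrite cards2 -(inj_eq idx_inj) i1 i2.
  apply/subset_leq_card/subsetP => y; rewrite !inE.
  by case/orP=> /eqP->; rewrite adj_sym ?a1 ?a2 ?i1 ?i2 //=; lia.
rewrite /low_bound !inE; have [->|x3] := eqVneq x v3.
  by apply: leq_trans (two _ a13 a23 _); rewrite ?i3 // ; case: (v3 != v1).
have [->|x4] := eqVneq x v4.
  by apply: leq_trans (two _ a14 a24 _); rewrite ?i4 // ; case: (v4 != v1).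
rewrite addn0; have [//|/parentP[y xy hy]] := eqVneq x v1.
by rewrite card_gt0; apply/set0Pn; exists y; rewrite !inE xy h_lt_idx ?hy.
Qed.

Let sum_low_bound S : \sum_(x in S) low_bound x =
  #|S| - (v1 \in S) + (v3 \in S) + (v4 \in S).
Proof.
have [i1 i2 i3 i4] := idx_v.
have n34 : v4 != v3 by rewrite -(inj_eq idx_inj) i3 i4.
have mem_sum v : \sum_(x in S) (x == v) = (v \in S).
  rewrite big_mkcond (bigD1 v) //= eqxx big1 ?addn0; first by case: (v \in S).
  by move=> x /negPf->; case: ifP.
have split1 : \sum_(x in S) (x != v1) + (v1 \in S) = #|S|.
  rewrite -mem_sum -big_split -sum1_card; apply: eq_bigr => x _ /=.
  by case: eqVneq.
rewrite -split1 addnK -!mem_sum -!big_split; apply: eq_bigr => x _ /=.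
rewrite /low_bound !inE -addnA; congr (_ + _).
by have [->|] := eqVneq x v3; rewrite // eq_sym (negPf n34).
Qed.

Let sum_low : \sum_(x : G) #|low x| = #|G|.+1.
Proof.
have := ecount_rank [set: G] idx_inj; rewrite ecountTT degG => /eqP.
rewrite eqn_pmul2l // => /eqP->; apply: eq_big => [x|x _]; first by rewrite inE.
by apply: eq_card => y; rewrite !inE andbT.
Qed.

(** The values of [low_bound] add up to [(n - 1) + 2], the number of edges, and so do those of
    [#|low x|], since each edge is counted at its later endpoint. A pointwise inequality between
    equal sums is an equality. *)
Let card_low x : #|low x| = low_bound x.
Proof.
have leif y : true -> low_bound y <= #|low y| ?= iff (low_bound y == #|low y|).
  by move=> _; split; first exact: low_bound_le.
have [_] := leqif_sum (P := predT) leif.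
have -> : \sum_(i : G) low_bound i = #|G|.+1.
  have := sum_low_bound setT; rewrite !inE cardsT.
  rewrite (eq_bigl predT) => [->|y]; last by rewrite inE.
  have : 0 < #|G| by apply/card_gt0P; exists v1.
  by move: #|_| => n; lia.
by rewrite sum_low eqxx => /esym/forallP/(_ x)/eqP.
Qed.

Let low_unique x y z : x \notin [:: v3; v4] ->
  adj x y -> idx y < idx x -> adj x z -> idx z < idx x -> y = z.
Proof.
move=> x34 xy lty xz ltz; have : #|low x| <= 1.
  by rewrite card_low /low_bound (negPf x34) addn0; case: (x != v1).
by move/card_le1_eqP; apply; rewrite !inE ?xy ?xz.
Qed.

Let lower_parent x y : x \notin [:: v3; v4] -> adj x y -> idx y < idx x ->
  h x = (h y).+1.
Proof.
move=> x34 xy lty; have [z xz hz] : exists2 z, adj x z & h x = (h z).+1.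
  by apply: parentP; apply: contraTneq lty => ->; have [-> _ _ _] := idx_v.
by rewrite (low_unique x34 xy lty xz) // h_lt_idx ?hz.
Qed.

Let down S := forall x y, idx x <= idx y -> y \in S -> x \in S.

Let first_in S x : down S -> idx x < #|S| -> x \in S.
Proof.
move=> S_down; apply: contraLR => xS; rewrite -leqNgt.
apply: (@leq_trans #|take (idx x) o|); last first.
  by apply: leq_trans (card_size _) _; rewrite size_take; case: ltnP => // /ltnW.
apply/subset_leq_card/subsetP => y yS; rewrite in_take // -/(idx y) ltnNge.
by apply: contra xS => /S_down; apply.
Qed.

(** Counted at later endpoints, the first [k] vertices span 0, 0, 1, 3 edges for [k] up to 3 and
    [k + 1] edges from [k = 4] on, which is where the minimum in [max_pairs] changes sides. *)
Let ecount_down S : down S -> max_pairs #|S| <= ecount S S.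
Proof.
move=> S_down; have [i1 i2 i3 i4] := idx_v.
rewrite (ecount_rank S idx_inj).
have -> : \sum_(x in S) #|[set y in nbrs x :&: S | idx y < idx x]| =
    \sum_(x in S) low_bound x.
  apply: eq_bigr => x xS; rewrite -card_low; apply: eq_card => y.
  rewrite !inE; case: adj => //=; case: ltnP; rewrite ?andbF ?andbT // => lt.
  by rewrite (S_down _ _ (ltnW lt) xS).
rewrite sum_low_bound; have := @first_in S v1 S_down; have := @first_in S v3 S_down.
have := @first_in S v4 S_down; rewrite i1 i3 i4 /max_pairs.
move: (v1 \in S) (v3 \in S) (v4 \in S) => b1 b3 b4.
case: #|S| => [|[|[|[|k]]]] H4 H3 H1.
- by [].
- by [].
- by case: b1 b3 b4 {H4 H3 H1} => -[] [].
- by rewrite H3 //; case: b1 b4 {H4 H3 H1} => -[].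
- by rewrite H4 // H3 // H1 //; apply: leq_trans (geq_minr _ _) _; lia.
Qed.

Let above_down a : down (above G a).
Proof. by move=> x y /deg_idx dyx; rewrite !inE => /leq_trans; apply. Qed.

(** An edge [yz] inside [B :\: A] would give the order [x], [y], [z], [v]. By the edge budget [x] is
    the only earlier neighbour of [v] and [y] that of [z]; then [x] and [y] lie on one level, and
    the BFS condition places [v] before [z], a contradiction. *)
Let sparse_between (A B : {set G}) x v :
    down A -> down B -> 1 < #|A| -> x \in A -> adj x v -> v \notin B ->
  ecount (B :\: A) (B :\: A) = 0.
Proof.
move=> A_down B_down A_gt1 xA xv vB; have [i1 i2 i3 i4] := idx_v.
have v1A : v1 \in A by apply: (first_in A_down); rewrite i1 ltnW.
have v2A : v2 \in A by apply: (first_in A_down); rewrite i2.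
have no_edge y z : y \in B :\: A -> z \in B :\: A -> idx y < idx z ->
    ~~ adj y z.
  rewrite !inE => /andP[yA yB] /andP[zA zB] yz; apply/negP => adj_yz.
  have xy : idx x < idx y.
    by rewrite ltnNge; apply: contra yA => /A_down; apply.
  have zv : idx z < idx v.
    by rewrite ltnNge; apply: contra vB => /B_down; apply.
  have y1 : 1 < idx y by rewrite ltnNge -i2; apply: contra yA => /A_down; apply.
  (* Since [y] comes after [v2], a [z] among [v3], [v4] would make [yz] the non-edge [v3 v4]. *)
  have z34 : z \notin [:: v3; v4].
    rewrite !inE; apply/negP => /orP[] /eqP E; move: yz adj_yz; rewrite E ?i3 ?i4.
      by rewrite ltnS leqNgt y1.
    rewrite ltnS => y3; have -> : y = v3.
      by apply: idx_inj; rewrite i3; apply/eqP; rewrite eqn_leq y3 y1.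
    exact/negP.
  have v34 : v \notin [:: v3; v4].
    have := leq_ltn_trans (leq_trans y1 (ltnW yz)) zv; rewrite !inE => v_gt2.
    apply/negP => /orP[] /eqP E; first by rewrite E i3 ltnn in v_gt2.
    by have := leq_ltn_trans (leq_ltn_trans y1 yz) zv; rewrite E i4 ltnn.
  have adj_zy : adj z y by rewrite adj_sym.
  have adj_vx : adj v x by rewrite adj_sym.
  have yv_lt : idx y < idx v := ltn_trans yz zv.
  have xz_lt : idx x < idx z := ltn_trans xy yz.
  have xv_lt : idx x < idx v := ltn_trans xy yv_lt.
  have hz := lower_parent z34 adj_zy yz.
  have hv := lower_parent v34 adj_vx xv_lt.
  (* As [z] precedes [v], [h y + 1 = h z <= h v = h x + 1]. *)
  have hxy : h x = h y.
    apply/eqP; rewrite eqn_leq (h_idx (ltnW xy)) /=.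
    by have := h_idx (ltnW zv); rewrite hz hv ltnS.
  case: bfs => _ _ _ /(_ x y v z).
  have nyv : ~~ adj y v.
    apply/negP => yv; have vy : adj v y by rewrite adj_sym.
    by have E := low_unique v34 adj_vx xv_lt vy yv_lt; rewrite E ltnn in xy.
  have nxz : ~~ adj x z.
    apply/negP => xz; have zx : adj z x by rewrite adj_sym.
    by have E := low_unique z34 adj_zy yz zx xz_lt; rewrite E ltnn in xy.
  rewrite !inE nyv nxz xv adj_yz => /(_ isT isT hxy hv).
  rewrite -[dist v1 z]/(h z) -[dist v1 x]/(h x) hxy hz.
  by move=> /(_ erefl xy) /(ltn_trans zv); rewrite -/(idx z) ltnn.
rewrite ecountE big1 // => y yC; rewrite big1 // => z zC.
apply/eqP; rewrite eqb0; case: (ltngtP (idx y) (idx z)) => [yz|zy|/idx_inj->].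
- exact: no_edge.
- by rewrite adj_sym no_edge.
- by rewrite adj_irrefl.
Qed.

Lemma BFS_tight : tight G.
Proof.
move=> a b _ ba A B; have [i1 i2 i3 i4] := idx_v.
have A_down := @above_down a; have B_down := @above_down b.
have sAB : A \subset B := above_subset G ba.
have full : (forall x, x \in A -> nbrs x \subset B) ->
    \sum_(x in A) deg x <= ecount A B.
  by move=> sub; apply: leq_sum => x /sub /setIidPl->.
have [A_le1|A_gt1] := leqP #|A| 1.
  have [A0|A_gt0] := posnP #|A|.
    by apply: Or31; rewrite (cards0_eq A0) big_set0.
  have v1A : v1 \in A by apply: (first_in A_down); rewrite i1.
  have A1 : A = [set v1].
    apply/eqP; rewrite eq_sym eqEcard sub1set v1A cards1; exact: A_le1.
  have [sub|] := boolP (nbrs v1 \subset B).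
    by apply: Or31; apply: full => x; rewrite A1 inE => /eqP->.
  case/subsetPn=> v; rewrite inE => adj1v vB; apply: Or33; split=> //.
  rewrite A1 /ecount big_set1.
  have v1B : v1 \in B by apply: (subsetP sAB).
  have := cardsD1 v1 B; rewrite v1B => -> /=.
  apply/subset_leq_card/subsetP => y; rewrite !inE => /andP[y1 yB].
  rewrite yB andbT.
  (* All of [B] precedes [v], so it lies within distance 1 of [v1]: every other vertex of [B] is a
     neighbour of [v1]. *)
  have hv : h v <= 1.
    by apply: leq_trans (dist_adj (cG _ _) adj1v) _; rewrite dist0.
  have yv : idx y <= idx v.
    rewrite leqNgt; apply: contra vB => /ltnW /B_down; apply; by rewrite inE.
  have [z yz hz] := parentP y1; have := h_idx yv.
  rewrite hz => hzv; suff -> : v1 = z by rewrite adj_sym.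
  by apply: (dist_eq0 (cG _ _)); apply/eqP; rewrite -leqn0 -ltnS (leq_trans hzv).
have [sub|] := boolP [forall x in A, nbrs x \subset B].
  by apply: Or31; apply: full => x xA; apply: (forall_inP sub).
rewrite negb_forall_in => /existsP[x /andP[xA /subsetPn[v]]].
rewrite inE => xv vB; apply: Or32.
have := ecount_subset sAB.
rewrite (sparse_between A_down B_down A_gt1 xA xv vB) addn0 => ->.
by apply: leq_add; apply: ecount_down.
Qed.

End BFSTight.

(** [K4e] has a single non-adjacent pair, so however the isomorphism places the four vertices,
    [v3 v4] is that pair. On ordinals this becomes arithmetic of four distinct numbers below 4. *)
Lemma K4e_base_adj (G : sgraph) (v1 v2 v3 v4 : G) :
    isomorphic (base_graph G) K4e -> base_set G = [set v1; v2; v3; v4] ->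
    uniq [:: v1; v2; v3; v4] -> ~~ adj v3 v4 ->
  [/\ adj v1 v2, adj v1 v3, adj v1 v4, adj v2 v3 & adj v2 v4].
Proof.
move=> [phi /bij_inj phi_inj phi_mono] baseE Uv na34.
have [m1 m2 m3 m4] : [/\ v1 \in base_set G, v2 \in base_set G,
    v3 \in base_set G & v4 \in base_set G].
  by rewrite baseE !inE !eqxx !orbT.
pose w (x : G) (m : x \in base_set G) : base_graph G := exist _ x m.
have adjE x y (mx : x \in base_set G) (my : y \in base_set G) :
    adj x y = K4e_adj (phi (w x mx)) (phi (w y my)).
  exact: esym (phi_mono (w x mx) (w y my)).
have neqE x y (mx : x \in base_set G) (my : y \in base_set G) :
    (phi (w x mx) == phi (w y my)) = (x == y).
  by rewrite (inj_eq phi_inj).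
move: na34 Uv; rewrite /= !inE -(neqE _ _ m1 m2) -(neqE _ _ m1 m3) -(neqE _ _ m1 m4).
rewrite -(neqE _ _ m2 m3) -(neqE _ _ m2 m4) -(neqE _ _ m3 m4).
rewrite (adjE _ _ m3 m4) (adjE _ _ m1 m2) (adjE _ _ m1 m3) (adjE _ _ m1 m4).
rewrite (adjE _ _ m2 m3) (adjE _ _ m2 m4) /K4e_adj.
move: (phi (w v1 m1)) (phi (w v2 m2)) (phi (w v3 m3)) (phi (w v4 m4)).
move=> i1 i2 i3 i4; rewrite -!val_eqE /=.
have := ltn_ord i1; have := ltn_ord i2; have := ltn_ord i3; have := ltn_ord i4.
move: (nat_of_ord i1) (nat_of_ord i2) (nat_of_ord i3) (nat_of_ord i4).
move=> {i1 i2 i3 i4 neqE adjE} i1 i2 i3 i4 *; split; lia.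
Qed.

Lemma BFS_on_K4e_tight (G : sgraph) : connected G ->
  \sum_(x : G) deg x = 2 * #|G|.+1 -> BFS_graph_on_K4e G -> tight G.
Proof.
move=> cG degG [_ iso [v1 [v2 [v3 [v4 [s [bfs baseE na34]]]]]]].
have Uv : uniq [:: v1; v2; v3; v4].
  case: bfs => -[+ _] _ _ _; rewrite -[_ :: _]/([:: v1; v2; v3; v4] ++ s).
  by rewrite cat_uniq => /and3P[].
have [a12 a13 a14 a23 a24] := K4e_base_adj iso baseE Uv na34.
exact: BFS_tight bfs a12 a13 a14 a23 a24 na34.
Qed.

(** * Edges of cycles and paths given as sequences *)

Section ConsecutivePairs.

Variable T : eqType.
Implicit Types (s p : seq T) (x y a : T).

Lemma mem_zip_rot1 s x y : uniq s ->
  ((x, y) \in zip s (rot 1 s)) = (x \in s) && (y == next s x).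
Proof.
case: s => [|a p] // Us; rewrite rot1_cons next_nth.
have szE : size (a :: p) = size (rcons p a) by rewrite size_rcons.
apply/(nthP (a, a))/andP => [[i]|[xs /eqP]].
  rewrite size_zip -szE minnn => lti; rewrite nth_zip // => -[<- <-].
  by rewrite mem_nth // index_uniq // nth_rcons_default.
rewrite xs => ->; exists (index x (a :: p)).
  by rewrite size_zip -szE minnn index_mem.
by rewrite nth_zip // nth_index // nth_rcons_default.
Qed.

(** A path is treated as a cycle without the wrap-around at its last vertex, so that [next] and
    [prev] serve for both. *)
Lemma mem_zip_behead a p x y : uniq (a :: p) ->
  ((x, y) \in zip (a :: p) p) =
  [&& x \in a :: p, x != last a p & y == next (a :: p) x].
Proof.
move=> Us; have lastE : last a p = nth a (a :: p) (size p) by rewrite nth_last.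
have szE : size (zip (a :: p) p) = size p by rewrite size_zip /= (minn_idPr _).
have nthE i : i < size p ->
    nth (a, a) (zip (a :: p) p) i = (nth a (a :: p) i, nth a p i).
  by move=> lti; rewrite nth_zip_cond szE lti.
rewrite next_nth; apply/(nthP (a, a))/and3P => [[i]|[xs xl]].
  rewrite szE => lti; rewrite nthE // => -[<- <-].
  rewrite mem_nth ?ltnS ?(ltnW lti) // lastE nth_uniq // ?ltnS ?(ltnW lti) //.
  by rewrite ltn_eqF // index_uniq // ltnS ltnW.
rewrite xs => /eqP->; exists (index x (a :: p)).
  rewrite szE ltn_neqAle -ltnS -[(size p).+1]/(size (a :: p)) index_mem xs andbT.
  by apply: contraNneq xl => E; rewrite lastE -E nth_index.
rewrite nthE ?nth_index // ltn_neqAle -ltnS -[(size p).+1]/(size (a :: p)).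
rewrite index_mem xs andbT.
by apply: contraNneq xl => E; rewrite lastE -E nth_index.
Qed.

Lemma next_last a p : uniq (a :: p) -> next (a :: p) (last a p) = a.
Proof.
move=> Us; rewrite next_nth mem_last.
have -> : last a p = nth a (a :: p) (size p) by rewrite nth_last.
by rewrite index_uniq // nth_default.
Qed.

Lemma next_neq s x : uniq s -> 2 <= size s -> x \in s -> next s x != x.
Proof.
move=> Us + xs; case/rot_to: (xs) => i s' E.
rewrite -(size_rot i) -(next_rot i Us) E; move: Us; rewrite -(rot_uniq i) E.
case: s' {E} => [|y s'] //=; rewrite !inE eqxx negb_or eq_sym.
by case/andP=> /andP[].
Qed.

Lemma next_neq_prev s x : uniq s -> 3 <= size s -> x \in s ->
  next s x != prev s x.
Proof.
move=> Us + xs; have nn: next s (prev s x) = x by exact: next_prev.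
apply: contraTneq => E; rewrite -E in nn; move: nn; case/rot_to: (xs) => i s' Er.
rewrite -(size_rot i) -!(next_rot i Us) Er; move: Us; rewrite -(rot_uniq i) Er.
case: s' {Er} => [|y [|z s']] //=; rewrite !inE !negb_or eqxx.
case/and3P=> /and3P[xy xz _] /andP[yz _] _.
by rewrite eq_sym (negPf xy) eqxx => E'; rewrite E' eqxx in xz.
Qed.

Lemma path_zip (e : rel T) a p :
  (forall x y, (x, y) \in zip (a :: p) p -> e x y) -> path e a p.
Proof.
elim: p a => [|b p IHp] a //= sub; rewrite sub ?inE ?eqxx //=.
by apply: IHp => x y xy; apply: sub; rewrite inE xy orbT.
Qed.

End ConsecutivePairs.

Section CycleEdges.

Variables (G : sgraph).
Implicit Types (s : seq G) (x y : G).

Lemma cycle_edgeC s : symmetric (cycle_edge (G := G) s).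
Proof. by move=> x y; rewrite /cycle_edge orbC. Qed.

Lemma path_edgeC s : symmetric (path_edge (G := G) s).
Proof. by move=> x y; rewrite /path_edge orbC. Qed.

Lemma cycle_edgeE s x y : uniq s ->
  cycle_edge s x y = (x \in s) && ((y == next s x) || (y == prev s x)).
Proof.
move=> Us; rewrite /cycle_edge !mem_zip_rot1 // andb_orr; congr (_ || _).
apply/andP/andP => -[ys /eqP->]; split; rewrite ?mem_next ?mem_prev //.
  by rewrite prev_next.
by rewrite next_prev.
Qed.

Lemma cycle_edge_mem s x y : uniq s -> cycle_edge s x y -> (x \in s) && (y \in s).
Proof.
move=> Us xy; move: (xy); rewrite cycle_edgeE // => /andP[-> _].
by move: xy; rewrite cycle_edgeC cycle_edgeE // => /andP[].
Qed.

Lemma cycle_edge_irrefl s x : uniq s -> 2 <= size s -> cycle_edge s x x = false.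
Proof.
move=> Us s2; rewrite cycle_edgeE //; case xs: (x \in s) => //=.
rewrite eq_sym (negPf (next_neq Us s2 xs)) /=; apply/eqP => E.
have := next_neq Us s2 (_ : prev s x \in s); rewrite mem_prev next_prev // -E.
by rewrite eqxx => /(_ xs).
Qed.

Definition cycle_nbrs s x : {set G} := [set y | cycle_edge s x y].

Lemma card_cycle_nbrs s x : uniq s -> 3 <= size s -> x \in s ->
  #|cycle_nbrs s x| = 2.
Proof.
move=> Us s3 xs; have -> : cycle_nbrs s x = [set next s x; prev s x].
  by apply/setP => y; rewrite !inE cycle_edgeE // xs.
by rewrite cards2 next_neq_prev.
Qed.

Lemma cycle_nbrs0 s x : uniq s -> x \notin s -> cycle_nbrs s x = set0.
Proof.
by move=> Us xs; apply/setP => y; rewrite !inE cycle_edgeE // (negPf xs).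
Qed.

Lemma connect_cycle_edge s x y : uniq s ->
  (forall u v, cycle_edge s u v -> adj u v) ->
  x \in s -> y \in s -> connect adj x y.
Proof.
move=> Us sub; apply: connect_cycle; have := cycle_next Us.
apply: (@sub_in_cycle _ (mem s)); last by apply/allP.
by move=> u v us _ /eqP <-; apply: sub; rewrite cycle_edgeE // [_ \in s]us eqxx.
Qed.

Lemma path_edgeE a p x y : uniq (a :: p) ->
  path_edge (a :: p) x y = (x \in a :: p) &&
    ((x != last a p) && (y == next (a :: p) x)
     || (x != a) && (y == prev (a :: p) x)).
Proof.
move=> Us; rewrite /path_edge /behead !mem_zip_behead // andb_orr.
congr (_ || _).
have headE z : z \in a :: p -> (prev (a :: p) z != last a p) = (z != a).
  move=> zs; congr (~~ _); apply/eqP/eqP => [E|->].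
    by rewrite -(next_prev Us z) E next_last.
  by have := prev_next Us (last a p); rewrite next_last.
apply/and3P/and3P => -[ys yl /eqP E]; split; rewrite ?E ?mem_next ?mem_prev //.
- by rewrite -headE ?mem_next // prev_next.
- by rewrite prev_next.
- by rewrite headE.
- by rewrite next_prev.
Qed.

Lemma path_edge_mem a p x y : uniq (a :: p) -> path_edge (a :: p) x y ->
  (x \in a :: p) && (y \in a :: p).
Proof.
move=> Us xy; move: (xy); rewrite path_edgeE // => /andP[-> _].
by move: xy; rewrite path_edgeC path_edgeE // => /andP[].
Qed.

Lemma path_edge_irrefl a p x : uniq (a :: p) -> path_edge (a :: p) x x = false.
Proof.
move=> Us; rewrite path_edgeE //; case xs: (x \in a :: p) => //; rewrite andTb.
case: p Us xs => [|b p] Us xs; first by move: xs; rewrite inE => /eqP->; rewrite eqxx.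
rewrite [x == next _ x]eq_sym (negPf (next_neq Us _ xs)) // andbF orFb.
apply/negP => /andP[_ /eqP E]; have := next_prev Us x; rewrite -E => /eqP.
by rewrite (negPf (next_neq Us _ xs)).
Qed.

Lemma path_edge_head a p y : uniq (a :: p) -> p != [::] ->
  path_edge (a :: p) a y = (y == head a p).
Proof.
case: p => [|b p] // Us _; rewrite path_edgeE // mem_head eqxx orbF.
have -> : a != last a (b :: p).
  by apply: contraTneq Us => {1}->; rewrite /= mem_last.
by rewrite /= eqxx.
Qed.

Lemma card_path_nbrs a p x : uniq (a :: p) -> x \in p ->
  #|[set y | path_edge (a :: p) x y]| = if x == last a p then 1 else 2.
Proof.
move=> Us xp; have xa : x != a.
  by apply: contraTneq xp => ->; case/andP: Us.
have xs : x \in a :: p by rewrite inE xp orbT.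
case: eqVneq => [xl|xl].
  rewrite (_ : [set y | _] = [set prev (a :: p) x]) ?cards1 //.
  by apply/setP => y; rewrite !inE path_edgeE // xs xa xl eqxx.
rewrite (_ : [set y | _] = [set next (a :: p) x; prev (a :: p) x]).
  rewrite cards2 next_neq_prev //=.
  (* An element of [p] other than the last forces [a :: p] to have at least three entries, as
     [next_neq_prev] requires. *)
  move: xl xa xp; case: p {Us xs} => [|b [|b' p]] //=; rewrite inE.
  by move=> /negPf->.
by apply/setP => y; rewrite !inE path_edgeE // xs xa xl.
Qed.

Lemma connect_path_edge a p x : uniq (a :: p) ->
  (forall u v, path_edge (a :: p) u v -> adj u v) ->
  x \in a :: p -> connect adj a x.
Proof.
move=> Us sub; apply: path_connect; apply: path_zip => u v uv.
by apply: sub; rewrite /path_edge /= uv.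
Qed.

End CycleEdges.

(** * Unions of cycles *)

Lemma geq_trans : transitive geq.
Proof. by move=> y x z /= yx zy; apply: leq_trans yx. Qed.

Lemma degree_seq_sorted (G : sgraph) : sorted geq (degree_seq G).
Proof. by apply: sort_sorted => x y; apply: leq_total. Qed.

Lemma degree_seq_perm (G : sgraph) (o : seq G) (ds : seq nat) :
    uniq o -> (forall v, v \in o) -> sorted geq ds ->
    perm_eq [seq deg v | v <- o] ds -> degree_seq G = ds.
Proof.
move=> Uo o_mem sds od; apply: (sorted_eq geq_trans) => //.
- by move=> x y; rewrite -eqn_leq => /eqP.
- exact: degree_seq_sorted.
rewrite perm_sort; apply: perm_trans od; apply: perm_map.
by apply: uniq_perm => // [|v]; rewrite ?enum_uniq ?o_mem ?mem_enum.
Qed.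

Lemma degree_seq_nseq (G : sgraph) (o : seq G) (d : nat) :
    uniq o -> (forall v, v \notin o -> deg v = d) ->
    sorted geq ([seq deg v | v <- o] ++ nseq (#|G| - size o) d) ->
  degree_seq G = [seq deg v | v <- o] ++ nseq (#|G| - size o) d.
Proof.
move=> Uo degd so; pose o' := [seq v <- enum G | v \notin o].
have o'_deg : [seq deg v | v <- o'] = nseq (size o') d.
  rewrite -(size_map (fun v => deg v)); apply/all_pred1P.
  by apply/allP => e /mapP[v]; rewrite mem_filter => /andP[/degd dv _] ->; rewrite /= dv.
have Uoo : uniq (o ++ o').
  rewrite cat_uniq Uo filter_uniq ?enum_uniq // andbT /=.
  by apply/hasPn => v; rewrite mem_filter => /andP[].
have oo_mem v : v \in o ++ o'.
  by rewrite mem_cat mem_filter mem_enum andbT orbN.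
have szo : size o + size o' = #|G|.
  rewrite -size_cat cardE; apply: perm_size; apply: uniq_perm => // [|v].
    exact: enum_uniq.
  by rewrite oo_mem mem_enum.
apply: (degree_seq_perm Uoo) => //.
by rewrite map_cat o'_deg -szo addKn.
Qed.

Lemma connected_from (G : sgraph) (c : G) :
  (forall x, connect adj c x) -> connected G.
Proof.
move=> cx x y; apply: connect_trans (cx y).
by rewrite (sym_connect_sym (@adj_sym G)).
Qed.

Section TwoCycles.

Variables (G : sgraph) (s1 s2 : seq G).
Hypothesis unionG : union_of_two_cycles s1 s2.

Lemma union_nbrs x : nbrs x = cycle_nbrs s1 x :|: cycle_nbrs s2 x.
Proof. by case: unionG => _ _ _ E; apply/setP => y; rewrite !inE E. Qed.

(** Inclusion-exclusion: the correction counts the edges at [x] that lie on both cycles. *)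
Lemma union_deg x : deg x = 2 * (x \in s1) + 2 * (x \in s2) -
  #|cycle_nbrs s1 x :&: cycle_nbrs s2 x|.
Proof.
case: unionG => -[U1 L1] [U2 L2] _ _; rewrite /deg union_nbrs cardsU.
congr (_ + _ - _).
  case: (boolP (x \in s1)) => xs; first by rewrite card_cycle_nbrs.
  by rewrite cycle_nbrs0 ?cards0.
case: (boolP (x \in s2)) => xs; first by rewrite card_cycle_nbrs.
by rewrite cycle_nbrs0 ?cards0.
Qed.

Lemma union_deg_one x : ~~ ((x \in s1) && (x \in s2)) -> deg x = 2.
Proof.
case: unionG => -[U1 L1] [U2 L2] /(_ x) mem12 _; rewrite union_deg.
case: (boolP (x \in s1)) mem12 => xs1 /=; case: (boolP (x \in s2)) => //= xs2 _ _.
  by rewrite [X in _ :&: X]cycle_nbrs0 // setI0 cards0.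
by rewrite cycle_nbrs0 // set0I cards0.
Qed.

Lemma union_connected c : c \in s1 -> c \in s2 -> connected G.
Proof.
case: unionG => -[U1 _] [U2 _] mem12 adjE cs1 cs2.
apply: (@connected_from _ c) => x; case/orP: (mem12 x) => xs.
  by apply: (connect_cycle_edge U1) => // u v uv; rewrite adjE uv.
by apply: (connect_cycle_edge U2) => // u v uv; rewrite adjE uv orbT.
Qed.

Lemma common_nbrs_sub x : cycle_nbrs s1 x :&: cycle_nbrs s2 x \subset
  [set y | [&& y \in s1, y \in s2 & y != x]].
Proof.
case: unionG => -[U1 L1] [U2 L2] _ _; apply/subsetP => y; rewrite !inE.
case/andP=> xy1 xy2; have /andP[_ ->] := cycle_edge_mem U1 xy1.
have /andP[_ ->] /= := cycle_edge_mem U2 xy2.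
by apply: contraTneq xy1 => ->; rewrite cycle_edge_irrefl // ltnW.
Qed.

End TwoCycles.

Lemma above_all (G : sgraph) b : (forall x : G, b < deg x) -> above G b = setT.
Proof. by move=> lt; apply/setP => x; rewrite !inE lt. Qed.

Lemma two_cycles_vertex_spec (G : sgraph) : two_cycles_sharing_vertex G ->
  [/\ connected G, degree_seq G = 4 :: nseq (#|G| - 1) 2 & tight G].
Proof.
case=> s1 [s2 [c [unionG cP]]].
have /andP[cs1 cs2] : (c \in s1) && (c \in s2) by rewrite cP.
have deg2 x : x != c -> deg x = 2.
  by move=> xc; apply: (union_deg_one unionG); rewrite cP.
have degc : deg c = 4.
  rewrite (union_deg unionG) cs1 cs2.
  suff -> : cycle_nbrs s1 c :&: cycle_nbrs s2 c = set0 by rewrite cards0.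
  apply/eqP; rewrite -subset0; apply: subset_trans (common_nbrs_sub unionG c) _.
  by apply/subsetP => y; rewrite !inE andbA cP andbN.
split; first exact: union_connected unionG _ cs1 cs2.
  rewrite (@degree_seq_nseq _ [:: c] 2) //=; first by rewrite degc.
    by move=> v; rewrite inE => /deg2.
  by rewrite degc; case: (#|G| - 1) => //= n; elim: n.
move=> a b b1 ba A B; have [b2|b2] := leqP b 1.
  apply: Or31; rewrite [B]above_all ?ecountTr // => x.
  by apply: leq_ltn_trans b2 _; have [->|/deg2->] := eqVneq x c; rewrite ?degc.
(* From threshold 2 on only [c] can remain, and the third alternative holds with [#|B| - 1 = 0]. *)
have sB : B \subset [set c].
  apply/subsetP => x; rewrite !inE; apply: contraLR => /deg2->.
  by rewrite -leqNgt.
have B_le1 : #|B| <= 1 by rewrite -(cards1 c) subset_leq_card.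
apply: Or33; split; last by case: #|B| B_le1 => [|[]].
exact: leq_trans (subset_leq_card (above_subset _ ba)) B_le1.
Qed.

Lemma triangle_cycle_spec (G : sgraph) : triangle_cycle_sharing_edge G ->
  [/\ connected G, degree_seq G = [:: 3, 3 & nseq (#|G| - 2) 2] & tight G].
Proof.
case=> s1 [s2 [a [b [unionG _ ab abP [e1 e2]]]]].
have /andP[as1 as2] : (a \in s1) && (a \in s2) by rewrite abP !inE eqxx.
have /andP[bs1 bs2] : (b \in s1) && (b \in s2) by rewrite abP !inE eqxx orbT.
have deg2 x : x \notin [:: a; b] -> deg x = 2.
  by move=> xab; apply: (union_deg_one unionG); rewrite abP.
have adjab : adj a b by case: unionG => _ _ _ ->; rewrite e1.
have dega : deg a = 3.
  rewrite (union_deg unionG) as1 as2.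
  suff -> : cycle_nbrs s1 a :&: cycle_nbrs s2 a = [set b] by rewrite cards1.
  apply/eqP; rewrite eqEsubset sub1set !inE e1 e2 /= andbT.
  apply: subset_trans (common_nbrs_sub unionG a) _.
  by apply/subsetP => y; rewrite !inE andbA abP !inE => /andP[/orP[/eqP->|]]; rewrite ?eqxx.
have degb : deg b = 3.
  rewrite (union_deg unionG) bs1 bs2.
  suff -> : cycle_nbrs s1 b :&: cycle_nbrs s2 b = [set a] by rewrite cards1.
  apply/eqP; rewrite eqEsubset sub1set !inE !(cycle_edgeC _ b) e1 e2 /= andbT.
  apply: subset_trans (common_nbrs_sub unionG b) _.
  apply/subsetP => y; rewrite !inE andbA abP !inE => /andP[/orP[|/eqP->]] //.
  by rewrite eqxx.
split; first exact: union_connected unionG _ as1 as2.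
  rewrite (@degree_seq_nseq _ [:: a; b] 2) //=; first by rewrite dega degb.
    by rewrite inE ab.
  by rewrite dega degb; case: (#|G| - 2) => //= n; elim: n.
move=> i j j1 ji A B; have [j2|j2] := leqP j 1.
  apply: Or31; rewrite [B]above_all ?ecountTr // => x.
  apply: leq_ltn_trans j2 _.
  have [->|xa] := eqVneq x a; first by rewrite dega.
  have [->|xb] := eqVneq x b; first by rewrite degb.
  by rewrite deg2 // !inE negb_or xa.
have [i3|i3] := leqP 3 i.
  apply: Or31; rewrite [A](_ : _ = set0) ?big_set0 //; apply/setP => x.
  rewrite !inE; apply/negbTE; rewrite -leqNgt.
  have [->|xa] := eqVneq x a; first by rewrite dega.
  have [->|xb] := eqVneq x b; first by rewrite degb.
  by rewrite deg2 ?(leq_trans _ i3) // !inE negb_or xa.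
have [Ei Ej] : i = 2 /\ j = 2 by lia.
have aboveE : above G 2 = [set a; b].
  apply/setP => x; rewrite !inE.
  have [->|xa] := eqVneq x a; first by rewrite dega.
  have [->|xb] := eqVneq x b; first by rewrite degb.
  by rewrite deg2 // !inE negb_or xa.
(* [max_pairs 2] is 2, and the shared edge [ab] contributes both of its ordered pairs. *)
apply: Or32; rewrite /A /B Ei Ej aboveE cards2 ab ecountE.
rewrite !(big_setU1, big_set1) ?inE //=.
by rewrite (adj_sym b a) adjab !adj_irrefl.
Qed.

(** * Two triangles with attached paths *)

(** Size and sum are two independent linear equations for the numbers of ones and twos. This
    identifies the degrees away from the centre without the individual path lengths. *)
Lemma perm_eq_12 (s t : seq nat) :
    all (fun d => 0 < d <= 2) s -> all (fun d => 0 < d <= 2) t ->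
    size s = size t -> sumn s = sumn t -> perm_eq s t.
Proof.
have counts r : all (fun d => 0 < d <= 2) r ->
    count_mem 1 r + count_mem 2 r = size r /\
    count_mem 1 r + 2 * count_mem 2 r = sumn r.
  by elim: r => [|d r IHr] //= /andP[d12 /IHr[]]; case: d d12 => [|[|[]]] //=; lia.
move=> s12 t12 szE sumE; have [] := counts s s12; have [] := counts t t12.
rewrite szE sumE => t1 t2 s1 s2.
have [c1E c2E] : count_mem 1 s = count_mem 1 t /\ count_mem 2 s = count_mem 2 t.
  by lia.
apply/allP => d; rewrite mem_cat => dst.
have : 0 < d <= 2 by case/orP: dst; [apply: (allP s12) | apply: (allP t12)].
by case: d {dst} => [|[|[]]] // _; apply/eqP.
Qed.

Lemma uniq_heads (T : eqType) (c : T) (ps : seq (seq T)) :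
  uniq (flatten ps) -> [::] \notin ps -> uniq [seq head c p | p <- ps].
Proof.
elim: ps => [|[|x p] ps IHps] //=; rewrite inE negb_or /= mem_cat negb_or.
rewrite cat_uniq => /and3P[/andP[_ xps] _ /andP[_ Ups]] ne; rewrite IHps // andbT.
apply: contra xps => /mapP[q qps ->]; apply/flattenP; exists q => //.
by case: q qps => [|y q] qps; [rewrite qps in ne | rewrite mem_head].
Qed.

Section TwoTriangles.

Variables (G : sgraph) (c a1 a2 b1 b2 : G) (ps : seq (seq G)).
Implicit Types (x y : G) (p q : seq G).
Hypothesis U : uniq [:: c, a1, a2, b1, b2 & flatten ps].
Hypothesis o_mem : forall v, v \in [:: c, a1, a2, b1, b2 & flatten ps].
Hypothesis ps_nil : [::] \notin ps.
Hypothesis lengths : almost_equal_lengths [seq size p | p <- ps].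
Hypothesis adjE : forall x y, adj x y =
  [|| cycle_edge [:: c; a1; a2] x y, cycle_edge [:: c; b1; b2] x y
    | has (fun p => path_edge (c :: p) x y) ps].

Let Ua : uniq [:: c; a1; a2].
Proof. exact: (mask_uniq U [:: true; true; true]). Qed.

Let Ub : uniq [:: c; b1; b2].
Proof. exact: (mask_uniq U [:: true; false; false; true; true]). Qed.

Let Ups : uniq (flatten ps).
Proof. by case/andP: U => _ /andP[_ /andP[_ /andP[_ /andP[_]]]]. Qed.

Let path_mem p x : p \in ps -> x \in p -> x \in flatten ps.
Proof. by move=> pps xp; apply/flattenP; exists p. Qed.

Let flat_notin x : x \in flatten ps -> x \notin [:: c; a1; a2; b1; b2].
Proof.
move: U; rewrite -[_ :: _]/([:: c; a1; a2; b1; b2] ++ _) cat_uniq.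
by case/and3P=> _ /hasPn/(_ x) H _; apply: H.
Qed.

Let Up p : p \in ps -> uniq (c :: p).
Proof.
move=> pps; rewrite cons_uniq; apply/andP; split.
  by apply/negP => /(path_mem pps)/flat_notin; rewrite !inE eqxx.
by case/splitPr: pps Ups => p1 p2; rewrite flatten_cat /= !cat_uniq => /and5P[].
Qed.

Let same_path p q x : p \in ps -> q \in ps -> x \in p -> x \in q -> p = q.
Proof.
elim: ps Ups => [|r rs IHr] //=; rewrite cat_uniq => /and3P[_ /hasPn dis Urs].
have no z t : t \in rs -> z \in t -> z \in r -> False.
  move=> trs zt zr; have /dis/negP : z \in flatten rs by apply/flattenP; exists t.
  exact.
rewrite !inE => /orP[/eqP->|prs] /orP[/eqP->|qrs] // xp xq.
- by case: (no x q).
- by case: (no x p).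
- exact: IHr.
Qed.

Let nbrs_path p x : p \in ps -> x \in p ->
  nbrs x = [set y | path_edge (c :: p) x y].
Proof.
move=> pps xp; apply/setP => y; rewrite !inE adjE !cycle_edgeE //.
have := flat_notin (path_mem pps xp); rewrite !inE !negb_or.
case/and5P=> /negPf xc /negPf-> /negPf-> /negPf-> /negPf->; rewrite xc /=.
apply/hasP/idP => [[q qps xy]|xy]; last by exists p.
have /andP[] := path_edge_mem (Up qps) xy; rewrite inE xc /= => xq _.
by rewrite (same_path pps qps xp xq).
Qed.

Let deg_path p x : p \in ps -> x \in p ->
  deg x = if x == last c p then 1 else 2.
Proof. by move=> pps xp; rewrite /deg (nbrs_path pps) // card_path_nbrs // Up. Qed.

Let not_path_edge x y : x \in [:: a1; a2; b1; b2] ->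
  has (fun p => path_edge (c :: p) x y) ps = false.
Proof.
move=> xab; apply/hasPn => p pps; apply/negP => /(path_edge_mem (Up pps)).
rewrite inE => /andP[/orP[/eqP E|xp] _].
  move: U xab; rewrite E /= !inE !negb_or.
  by case/and5P=> /and5P[/negPf-> /negPf-> /negPf-> /negPf->].
by have := flat_notin (path_mem pps xp); rewrite inE xab orbT.
Qed.

Let deg_a x : x \in [:: a1; a2] -> deg x = 2.
Proof.
move=> xa; rewrite -(card_cycle_nbrs Ua (isT : 3 <= 3) (_ : x \in _)); last first.
  by rewrite inE xa orbT.
apply: eq_card => y; rewrite !inE adjE not_path_edge; last first.
  by move: xa; rewrite !inE => /orP[] ->; rewrite ?orbT.
rewrite orbF [X in _ || X]cycle_edgeE // [x \in _](_ : _ = false) ?orbF //.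
apply/negbTE; move: U xa; rewrite /= !inE !negb_or.
by case/and5P=> /and5P[c1 c2 _ _ _] /and4P[n1 n2 n3 _] /and3P[n4 n5 _] _ _ /orP[] /eqP->;
  rewrite ?n2 ?n3 ?n4 ?n5 eq_sym ?c1 ?c2.
Qed.

Let deg_b x : x \in [:: b1; b2] -> deg x = 2.
Proof.
move=> xb; rewrite -(card_cycle_nbrs Ub (isT : 3 <= 3) (_ : x \in _)); last first.
  by rewrite inE xb orbT.
apply: eq_card => y; rewrite !inE adjE not_path_edge; last first.
  by move: xb; rewrite !inE => /orP[] ->; rewrite ?orbT.
rewrite orbF [X in X || _]cycle_edgeE // [x \in _](_ : _ = false) //.
apply/negbTE; move: U xb; rewrite /= !inE !negb_or.
by case/and5P=> /and5P[_ _ c3 c4 _] /and4P[_ n2 n3 _] /and3P[n4 n5 _] _ _ /orP[] /eqP->;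
  rewrite eq_sym ?c3 ?c4 /= eq_sym ?n2 ?n3 /= eq_sym ?n4 ?n5.
Qed.

Let nbrs_c : nbrs c =
  [set y in [:: a1; a2; b1; b2] ++ [seq head c p | p <- ps]].
Proof.
have tri u v : uniq [:: c; u; v] ->
    (next [:: c; u; v] c = u) * (prev [:: c; u; v] c = v).
  by rewrite /= eqxx !inE !negb_or => /andP[/andP[/negPf-> /negPf->] _].
apply/setP => y; rewrite !inE adjE !cycle_edgeE // !mem_head !tri //=.
rewrite -!orbA; do !congr (_ || _).
apply/hasP/mapP => [[p pps]|[p pps ->]]; (have p0 : p != [::] by
  apply: contraTneq pps => ->); last exists p => //.
  by rewrite path_edge_head ?Up // => /eqP->; exists p.
by rewrite path_edge_head ?Up.
Qed.

Let deg_c : deg c = 4 + size ps.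
Proof.
rewrite /deg nbrs_c cardsE; set l := _ ++ _.
have /card_uniqP-> : uniq l; last by rewrite size_cat size_map.
rewrite cat_uniq uniq_heads // andbT; apply/andP; split.
  exact: (mask_uniq U [:: false; true; true; true; true]).
apply/hasPn => _ /mapP[p pps ->]; apply/negP => H.
have : head c p \in flatten ps.
  apply: (path_mem pps); case: p pps {H} => [|x p] pps; last exact: mem_head.
  by move: ps_nil; rewrite pps.
by move/flat_notin; rewrite inE H orbT.
Qed.

Let sum_deg_path p : p \in ps -> sumn [seq deg v | v <- p] + 1 = 2 * size p.
Proof.
move=> pps; have := @deg_path p _ pps; have := Up pps.
case/lastP: p pps => [|p z] pps; first by move: ps_nil; rewrite pps.
rewrite last_rcons /= rcons_uniq => /and3P[_ zp _] degp.
rewrite map_rcons -cats1 sumn_cat size_rcons /= degp ?mem_rcons ?mem_head // eqxx.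
rewrite (_ : [seq deg v | v <- p] = nseq (size p) 2).
  by rewrite sumn_nseq mulnS addn0 -addnA addnC.
rewrite -[in RHS](size_map (fun v => deg v) p); apply/all_pred1P.
apply/allP => d /mapP[v vp ->] /=; rewrite degp ?mem_rcons ?inE ?vp ?orbT //.
by case: (v =P z) => // E; rewrite E (negPf zp) in vp.
Qed.

Let sum_deg_flatten :
  sumn [seq deg v | v <- flatten ps] + size ps = 2 * size (flatten ps).
Proof.
elim: ps sum_deg_path => [|p qs IHq] //= H.
rewrite map_cat sumn_cat size_cat; have := H p (mem_head _ _).
have {}IHq : sumn [seq deg v | v <- flatten qs] + size qs = 2 * size (flatten qs).
  by apply: IHq => q qqs; apply: H; rewrite inE qqs orbT.
lia.
Qed.

Let deg_12 x : x != c -> 0 < deg x <= 2.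
Proof.
move=> xc; have := o_mem x; rewrite inE (negPf xc) /=.
rewrite -[_ :: _]/([:: a1; a2] ++ [:: b1; b2] ++ flatten ps) !mem_cat.
case/or3P=> [/deg_a->|/deg_b->|/flattenP[p pps /(deg_path pps)->]] //.
by case: ifP.
Qed.

Lemma two_triangles_connected : connected G.
Proof.
apply: (@connected_from _ c) => x; have := o_mem x.
have tri s : uniq s -> c \in s -> (forall u v, cycle_edge s u v -> adj u v) ->
    x \in s -> connect adj c x.
  by move=> Us cs sub xs; apply: connect_cycle_edge Us sub cs xs.
rewrite -[_ :: _]/([:: c; a1; a2] ++ [:: b1; b2] ++ flatten ps) !mem_cat.
case/or3P=> [|xb|/flattenP[p pps xp]].
- by apply: tri => //; rewrite ?mem_head // => u v uv; rewrite adjE uv.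
- have xs : x \in [:: c; b1; b2] by rewrite in_cons xb orbT.
  by apply: (tri _ Ub _ _ xs); rewrite ?mem_head // => u v uv; rewrite adjE uv orbT.
- apply: (@connect_path_edge _ c p); rewrite ?Up ?inE ?xp ?orbT // => u v uv.
  by rewrite adjE; apply/or3P/Or33/hasP; exists p.
Qed.

Lemma two_triangles_degree_seq (ds : seq nat) :
    sorted geq (4 + size ps :: ds) -> all (fun d => 0 < d <= 2) ds ->
    size ds = #|G|.-1 -> sumn ds + size ps = 2 * size ds ->
  degree_seq G = 4 + size ps :: ds.
Proof.
move=> so ds12 szd sumd; apply: (degree_seq_perm U) => //.
rewrite /= deg_c perm_cons -[_ :: _]/([seq deg v | v <- [:: a1, a2, b1, b2 & flatten ps]]).
have szo : (size (flatten ps)).+4 = size ds.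
  rewrite szd -[LHS]/(size [:: c, a1, a2, b1, b2 & flatten ps]).-1.
  by rewrite -(card_uniqP U); congr _.-1; apply: eq_card => x; rewrite o_mem.
apply: perm_eq_12 => //.
- apply/allP => d /mapP[v vo ->]; apply: deg_12; apply: contraTneq vo => ->.
  by case/andP: U.
- by rewrite size_map.
rewrite /=.
have [-> ->] : deg a1 = 2 /\ deg a2 = 2 by rewrite !deg_a ?inE ?eqxx ?orbT.
have [-> ->] : deg b1 = 2 /\ deg b2 = 2 by rewrite !deg_b ?inE ?eqxx ?orbT.
have := sum_deg_flatten; lia.
Qed.

Hypothesis degG : \sum_(x : G) deg x = 2 * #|G|.+1.

(** At threshold 1 the bound [ecount_above1] suffices. For larger [a], [A] is at most the centre; if
    a neighbour of the centre lies outside [B], then either [b >= 2] and [B] is the centre alone, or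
    some path has length one and almost equal lengths bring every vertex of degree two next to the
    centre. *)
Lemma two_triangles_tight : tight G.
Proof.
move=> a b b1' ba A B.
have A_sub : 1 < a -> A \subset [set c].
  move=> a1'; apply/subsetP => x; rewrite !inE; apply: contraLR => /deg_12 /andP[_ d2].
  by rewrite -leqNgt (leq_trans d2).
have [a_le1|a_gt1] := leqP a 1.
  have [Ea Eb] : a = 1 /\ b = 1 by lia.
  apply: Or32; have := ecount_above1 degG; rewrite /A /B Ea Eb.
  rewrite /max_pairs; move: (ecount _ _) #|_| => e n; lia.
have A_le1 : #|A| <= 1 by rewrite -(cards1 c) subset_leq_card // A_sub.
have [A0|/set0Pn[x xA]] := eqVneq A set0; first by apply: Or31; rewrite A0 big_set0.
have A1 : A = [set c].
  apply/eqP; rewrite eqEcard A_sub // cards1 card_gt0; apply/set0Pn; by exists x.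
rewrite A1 /ecount !big_set1.
have [sub|] := boolP (nbrs c \subset B).
  by apply: Or31; rewrite (setIidPl sub).
case/subsetPn=> v; rewrite inE => cv vB; apply: Or33; split; first by rewrite cards1.
have cB : c \in B by apply: (subsetP (above_subset G ba)); rewrite -/A A1 inE.
have := cardsD1 c B; rewrite cB => -> /=.
apply/subset_leq_card/subsetP => y; rewrite in_setD1 in_setI => /andP[yc yB].
rewrite yB andbT inE.
have dv : deg v <= b by rewrite leqNgt; move: vB; rewrite inE.
have [b_gt1|b_le1] := ltnP 1 b.
  have /andP[_ dy] := deg_12 yc.
  by move: yB; rewrite inE ltnNge (leq_trans dy b_gt1).
have [p pps vE] : exists2 p, p \in ps & v = head c p.
  have : v \in nbrs c by rewrite inE.
  rewrite nbrs_c inE mem_cat => /orP[vab|/mapP[p pps ->]]; last by exists p.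
  have := leq_trans dv b_le1; suff -> : deg v = 2 by [].
  move: vab; rewrite -[_ :: _]/([:: a1; a2] ++ [:: b1; b2]) mem_cat.
  by case/orP; [apply: deg_a | apply: deg_b].
have p0 : p != [::] by apply: contraTneq pps => ->.
have vp : v \in p by rewrite vE; case: (p) p0 => // z q _; exact: mem_head.
have vl : v = last c p.
  have := deg_path pps vp; case: eqP => // _ dv2.
  by have := leq_trans dv b_le1; rewrite dv2.
have p1 : size p = 1.
  have := Up pps; move: vl p0; rewrite vE; case: (p) => [|z [|z' q]] //= -> _.
  by rewrite mem_last andbF.
(* With no path longer than two, a vertex of degree two on a path is the first one after [c]. *)
have short q : q \in ps -> size q <= 2.
  by move=> qps; rewrite -p1 lengths // map_f.
have : y \in c :: [:: a1; a2; b1; b2] ++ flatten ps := o_mem y.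
rewrite inE (negPf yc) mem_cat /= => yo.
suff : y \in nbrs c by rewrite inE.
rewrite nbrs_c inE mem_cat; case/orP: yo => [->//|/flattenP[q qps yq]].
apply/orP; right; apply/mapP; exists q => //.
have := short q qps; have := deg_path qps yq; move: yB; rewrite inE.
case: eqVneq => [_ + E|yl _ _]; first by rewrite E ltnNge b1'.
case: (q) yq yl => [|z [|z' [|]]] //=; rewrite !inE ?orbF.
  by move/eqP->.
by case/orP=> /eqP->; rewrite ?eqxx.
Qed.

End TwoTriangles.

(** * Bicyclic degree sequences *)

Lemma deg_gt0 (G : sgraph) (x : G) : connected G -> 1 < #|G| -> 0 < deg x.
Proof.
move=> cG G2; have [y yx] : exists y, y != x.
  apply/existsP; apply: contraTT G2; rewrite negb_exists => /forallP all_x.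
  rewrite -leqNgt -(card1 x); apply/subset_leq_card/subsetP => y _.
  by rewrite inE; apply: negbNE.
case/connectP: (cG x y) yx => -[|z p] /= ; first by move=> _ ->; rewrite eqxx.
by move=> /andP[xz _] _ _; apply/card_gt0P; exists z; rewrite inE.
Qed.

(* With at most one vertex of degree above two, the vertices of degree above one
   span at most 3 (m - 1) adjacent ordered pairs but at least 2 (m + 1). *)
Lemma card_above1_ge5 (G : sgraph) : \sum_(x : G) deg x = 2 * #|G|.+1 ->
  #|above G 2| <= 1 -> 5 <= #|above G 1|.
Proof.
move=> degG D2; have := ecount_above1 degG; set D := above G 1 => D_lb.
have [c c2] : exists c : G, 2 < deg c.
  apply/existsP; rewrite -[[exists c, _]]negbK negb_exists; apply/negP => /forallP le2.
  have : \sum_(x : G) deg x <= #|G| * 2.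
    by rewrite -sum_nat_const; apply: leq_sum => x _; rewrite leqNgt le2.
  by rewrite degG; move: #|G| => n; lia.
have deg2 x : x != c -> deg x <= 2.
  apply: contraNT; rewrite -ltnNge => x2; apply/eqP.
  by apply: (card_le1_eqP D2); rewrite inE.
have cD : c \in D by rewrite inE ltnW.
have D_ub : ecount D D <= #|D|.-1 + #|D :\ c| * 2.
  rewrite /ecount (big_setD1 c) //=; apply: leq_add; first exact: card_nbrsI.
  rewrite -sum_nat_const; apply: leq_sum => x; rewrite in_setD1 => /andP[/deg2 le2 _].
  exact: leq_trans (subset_leq_card (subsetIl _ _)) le2.
have := cardsD1 c D; rewrite cD; move: D_lb D_ub.
by move: (ecount D D) #|D| #|D :\ c| => e m k; lia.
Qed.

(* cycle_edge and path_edge use the graph only through its vertex type, so they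
   can be taken in this graph to define the adjacency of another one. *)
Definition discrete_graph (T : finType) : sgraph :=
  @SGraph T (fun _ _ => false) (fun _ _ => erefl) (fun _ => erefl).

Section SeqFacts.

Implicit Types (t : seq nat).

Lemma sumn_le2 t : all (fun d => d <= 2) t -> sumn t <= 2 * size t.
Proof. by elim: t => [|d t IHt] //= /andP[d2 /IHt]; lia. Qed.

Lemma sumn_ge2 t : all (fun d => 2 <= d) t -> 2 * size t <= sumn t.
Proof. by elim: t => [|d t IHt] //= /andP[d2 /IHt]; lia. Qed.

Lemma sumn_eq2 t : all (fun d => 2 <= d) t -> sumn t <= 2 * size t ->
  t = nseq (size t) 2.
Proof.
elim: t => [|d t IHt] //= /andP[d2 t2] le; have := sumn_ge2 t2 => ge.
by congr (_ :: _); [lia | apply: IHt => //; lia].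
Qed.

Lemma sumn_12 t : all (fun d => 0 < d <= 2) t ->
  sumn t = size t + count (fun d => 1 < d) t.
Proof. by elim: t => [|d t IHt] //= /andP[d12 /IHt ->]; case: ltnP; lia. Qed.

Lemma sorted_ge_last t d : sorted geq t -> d \in t -> last 0 t <= d.
Proof.
case/lastP: t => [|t x] //; rewrite (sorted_pairwise geq_trans) pairwise_rcons.
rewrite last_rcons mem_rcons inE => /andP[/allP le _] /orP[/eqP->//|].
exact: le.
Qed.

Lemma sumn_lt2 t : all (fun d => d <= 2) t -> last 0 t = 1 -> sumn t < 2 * size t.
Proof.
case/lastP: t => [|t x] //; rewrite all_rcons last_rcons => /andP[_ /sumn_le2].
by rewrite -cats1 sumn_cat size_cat /= => le ->; lia.
Qed.

End SeqFacts.

(** Past [bicyclic_degree_seqP] the graph realizing [pi] is forgotten and only this arithmetic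
    remains. The last two fields provide enough vertices of degree above one for [K_4 - e] and for
    two triangles with a common vertex. *)
Record bicyclic_spec (pi : seq nat) : Prop := BicyclicSpec {
  spec_sorted : sorted geq pi;
  spec_sum : sumn pi = 2 * (size pi).+1;
  spec_pos : all (fun d => 0 < d) pi;
  spec_ge4 : 4 <= count (fun d => 1 < d) pi;
  spec_ge5 : count (fun d => 2 < d) pi <= 1 -> 5 <= count (fun d => 1 < d) pi }.

Lemma bicyclic_degree_seqP pi : bicyclic_degree_seq pi -> bicyclic_spec pi.
Proof.
case=> G [cG eG] <-; have degG : \sum_(x : G) deg x = 2 * #|G|.+1.
  by rewrite sum_deg eG.
have D4 := card_above1_ge4 cG degG.
split; rewrite ?degree_seq_sorted ?sumn_degree_seq ?size_degree_seq -?card_above //.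
  apply/allP => d; rewrite mem_sort => /mapP[x _ ->]; apply: deg_gt0 => //.
  by apply: leq_trans (leq_trans (leq_trans _ D4) (max_card _)).
exact: card_above1_ge5.
Qed.

Lemma Gamma_sum_deg pi (G : sgraph) : bicyclic_spec pi -> Gamma pi G ->
  \sum_(x : G) deg x = 2 * #|G|.+1.
Proof. by move=> [_ sumE _ _ _] [_ E]; rewrite -sumn_degree_seq -size_degree_seq E. Qed.

Variant bicyclic_cases (pi : seq nat) : Prop :=
| BicyclicBranched of last 0 pi = 1 & 3 <= nth 0 pi 1 <= nth 0 pi 0
| BicyclicStar d ds of pi = d.+4 :: ds & 0 < d & all (fun e => 0 < e <= 2) ds
    & nth 0 pi 1 = 2 & last 0 pi = 1
| BicyclicEight of pi = 4 :: nseq (size pi - 1) 2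
| BicyclicTheta of pi = [:: 3, 3 & nseq (size pi - 2) 2].

(** The differences [d_i - 2] add up to 2. Without ones they are nonnegative, leaving a single 4 or
    two 3s. If a 1 occurs and [d_2 <= 2], the first entry has to make up for it, so [d_1 >= 5]; and
    [d_2 = 1] is impossible because four entries exceed 1. *)
Lemma bicyclic_exhaust pi : bicyclic_spec pi -> bicyclic_cases pi.
Proof.
case=> so sumE pos ge4 _; case: pi so sumE pos ge4 => [|d1 [|d2 t]] //=.
  by move=> _ _ _; case: (1 < d1).
case/andP=> d21 so sumE /and3P[d10 d20 t0] ge4.
have t_le : all (fun d => d <= d2) t.
  by have := order_path_min geq_trans so.
have [last1|last_neq1] := eqVneq (last d2 t) 1.
  have [d2_ge3|d2_le2] := leqP 3 d2.
    by apply: BicyclicBranched; rewrite //= d2_ge3.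
  have le2 : all (fun d => d <= 2) (d2 :: t).
    by rewrite /= -ltnS d2_le2; apply: sub_all t_le => d /leq_trans; apply.
  have lt2 := sumn_lt2 le2 last1.
  have d2E : d2 = 2.
    apply/eqP; rewrite eqn_leq -ltnS d2_le2 ltnNge; apply/negP => d2_le1.
    have H : all (fun d => d <= 1) (d2 :: t).
      by rewrite /= d2_le1; apply: sub_all t_le => d /leq_trans; apply.
    move: ge4; rewrite -[_ + (_ + _)]/((1 < d1) + count (fun d => 1 < d) (d2 :: t)).
    rewrite (_ : count _ _ = 0); first by case: (1 < d1).
    apply/eqP; rewrite -leqn0 leqNgt -has_count; apply/hasPn => d dt.
    by rewrite -leqNgt (allP H).
  have d1_gt4 : 4 < d1 by move: lt2; rewrite /=; lia.
  apply: (@BicyclicStar _ (d1 - 4) (d2 :: t)) => //.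
  - by congr (_ :: _); lia.
  - by lia.
  - apply/allP => d dt; rewrite (allP le2) // andbT.
    by apply: (@allP _ _ (d2 :: t)) dt; rewrite /= d20.
have ge2 : all (fun d => 2 <= d) [:: d1, d2 & t].
  have so' : sorted geq [:: d1, d2 & t] by rewrite /= d21.
  apply/allP => d /(sorted_ge_last so'); apply: leq_trans.
  rewrite ltn_neqAle eq_sym last_neq1.
  by apply: (@allP _ (fun d => 0 < d) (d2 :: t)); rewrite /= ?d20 ?mem_last.
case/and3P: ge2 => d1_ge2 d2_ge2 t_ge2; have sum_ge := sumn_ge2 t_ge2.
have [d2_le2|d2_gt2] := leqP d2 2.
  have t_le2 : all (fun d => d <= 2) t.
    by apply: sub_all t_le => d /leq_trans; apply.
  have sum_le := sumn_le2 t_le2.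
  have [d1E d2E] : d1 = 4 /\ d2 = 2 by lia.
  apply: BicyclicEight; rewrite (_ : size _ - 1 = (size t).+1) ?subn1 //.
  by rewrite d1E d2E {1}(sumn_eq2 t_ge2 sum_le).
have [d1E d2E] : d1 = 3 /\ d2 = 3 by lia.
apply: BicyclicTheta; rewrite (_ : size _ - 2 = size t) ?subn2 //.
by rewrite d1E d2E {1}(sumn_eq2 t_ge2) //; lia.
Qed.

(** * Existence *)

Section Constructions.

Variable n : nat.
Let T := 'I_n.
Let cyc (s : seq T) : rel T := cycle_edge (G := discrete_graph T) s.
Let pth (s : seq T) : rel T := path_edge (G := discrete_graph T) s.

Let cyc_sym s : symmetric (cyc s).
Proof. exact: (@cycle_edgeC (discrete_graph T)). Qed.

Let cyc_irrefl s : uniq s -> 2 <= size s -> irreflexive (cyc s).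
Proof. by move=> Us s2 x; apply: (@cycle_edge_irrefl (discrete_graph T)). Qed.

Let ord_uniq : uniq (enum T). Proof. exact: enum_uniq. Qed.
Let ord_mem x : x \in enum T. Proof. exact: mem_enum. Qed.
Let ord_size : size (enum T) = n. Proof. exact: size_enum_ord. Qed.

Section Union.

Variables (s1 s2 : seq T).
Hypotheses (U1 : uniq s1) (L1 : 3 <= size s1) (U2 : uniq s2) (L2 : 3 <= size s2).
Hypothesis cover : forall v, (v \in s1) || (v \in s2).

Let union_adj : rel T := fun x y => cyc s1 x y || cyc s2 x y.

Let union_sym : symmetric union_adj.
Proof. by move=> x y; rewrite /union_adj !(cyc_sym _ x). Qed.

Let union_irrefl : irreflexive union_adj.
Proof. by move=> x; rewrite /union_adj !cyc_irrefl // ltnW. Qed.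

Lemma union_exists : exists adj0 (sym : symmetric adj0) (irr : irreflexive adj0),
  @union_of_two_cycles (SGraph sym irr) s1 s2.
Proof. by exists union_adj, union_sym, union_irrefl. Qed.

End Union.

Lemma two_cycles_exists : 5 <= n ->
  exists2 G : sgraph, #|G| = n & two_cycles_sharing_vertex G.
Proof.
rewrite -{1}ord_size; move: ord_uniq ord_mem.
case: (enum T) => [|c [|x1 [|x2 [|x3 [|x4 r]]]]] // U mem_r _.
pose s1 := [:: c; x1; x2]; pose s2 := [:: c, x3, x4 & r].
have U1 : uniq s1 := mask_uniq U [:: true; true; true].
have U2 : uniq s2.
  have := mask_uniq U (true :: false :: false :: nseq (size r).+2 true).
  by rewrite /= mask_true.
have cover v : (v \in s1) || (v \in s2).
  by have := mem_r v; rewrite !inE; case: (v == c); case: (v == x1) => //=.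
have [adj0 [sym [irr unionG]]] := union_exists U1 isT U2 isT cover.
exists (SGraph sym irr); first exact: card_ord.
exists s1, s2, c; split=> // v.
have [->|vc] := eqVneq v c; first by rewrite !inE eqxx.
apply/negP; rewrite !inE (negPf vc) /= => /andP[/orP[] /eqP-> H];
  by move: U; rewrite /= !inE !negb_or; move: H => /or3P[] H;
     rewrite H /= ?andbF.
Qed.

Lemma triangle_cycle_exists : 4 <= n ->
  exists2 G : sgraph, #|G| = n & triangle_cycle_sharing_edge G.
Proof.
rewrite -{1}ord_size; move: ord_uniq ord_mem.
case: (enum T) => [|t [|a [|b [|x r]]]] // U mem_r _.
pose s1 := [:: t; a; b]; pose s2 := [:: a, b, x & r].
have U1 : uniq s1 := mask_uniq U [:: true; true; true].
have U2 : uniq s2 by case/andP: U.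
have cover v : (v \in s1) || (v \in s2).
  by have := mem_r v; rewrite !inE; case: (v == t); case: (v == a); case: (v == b).
have [adj0 [sym [irr unionG]]] := union_exists U1 isT U2 isT cover.
exists (SGraph sym irr); first exact: card_ord.
exists s1, s2, a, b; split=> //.
- by case/and3P: U2; rewrite inE negb_or => /andP[].
- move=> v; rewrite !inE; have [->|vt] := eqVneq v t.
    by case/andP: U; rewrite !inE !negb_or => /and4P[/negPf-> /negPf-> /negPf-> /negPf->].
  by case: (v == a); case: (v == b).
- by split; rewrite /cycle_edge /= !inE !eqxx ?orbT.
Qed.

(** Division with remainder: [m %% k] parts exceed the quotient by one, and [k <= m] keeps all parts
    positive. *)
Lemma almost_equal_split (m k : nat) : 0 < k <= m -> exists sh : seq nat,
  [/\ sumn sh = m, size sh = k, 0 \notin sh & almost_equal_lengths sh].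
Proof.
case/andP=> k0 km; exists (nseq (m %% k) (m %/ k).+1 ++ nseq (k - m %% k) (m %/ k)).
have q0 : 0 < m %/ k by rewrite divn_gt0.
have rk := ltn_pmod m k0; split.
- rewrite sumn_cat !sumn_nseq mulSn -addnA mulnBr subnKC; last first.
    by rewrite leq_mul2l ltnW ?orbT.
  by rewrite addnC -divn_eq.
- by rewrite size_cat !size_nseq subnKC // ltnW.
- rewrite mem_cat !mem_nseq negb_or /= andbF /= negb_and.
  by rewrite -(eq_sym (m %/ k)) (gtn_eqF q0) orbT.
move=> x y; rewrite !mem_cat !mem_nseq.
by case/orP=> /andP[_ /eqP->] /orP[] /andP[_ /eqP->]; lia.
Qed.

Lemma two_triangles_exists k : 0 < k -> k + 5 <= n ->
  exists2 G : sgraph, #|G| = n & two_triangles_with_paths G k.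
Proof.
move=> k0; rewrite -{1}ord_size; move: ord_uniq ord_mem.
case: (enum T) => [|c [|a1 [|a2 [|b1 [|b2 r]]]]] //=; try by lia.
move=> U mem_r kn; have [|sh [sumE szE sh0 ael]] := @almost_equal_split (size r) k.
  by rewrite k0 /=; lia.
pose ps := reshape sh r.
have flatE : flatten ps = r by apply: reshapeKr; rewrite sumE.
have shapeE : [seq size p | p <- ps] = sh by apply: reshapeKl; rewrite sumE.
have ps_nil : [::] \notin ps.
  by apply: contra sh0 => /(map_f size); rewrite shapeE.
pose Ta := [:: c; a1; a2]; pose Tb := [:: c; b1; b2].
have Ua : uniq Ta := mask_uniq (U : uniq [:: c, a1, a2, b1, b2 & r]) [:: true; true; true].
have Ub : uniq Tb := mask_uniq (U : uniq [:: c, a1, a2, b1, b2 & r])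
  [:: true; false; false; true; true].
pose tri_adj : rel T := fun x y =>
  [|| cyc Ta x y, cyc Tb x y | has (fun p => pth (c :: p) x y) ps].
have Up p : p \in ps -> uniq (c :: p).
  move=> pps; rewrite cons_uniq; apply/andP; split.
    apply: contraL U => cp; have : c \in r by rewrite -flatE; apply/flattenP; exists p.
    by rewrite !inE => ->; rewrite !orbT.
  have : uniq r by move: U => /and5P[_ _ _ _ /andP[]].
  rewrite -flatE; case/splitPr: pps => p1 p2; rewrite flatten_cat /= !cat_uniq.
  by case/and5P.
have sym : symmetric tri_adj.
  move=> x y; rewrite /tri_adj !(cyc_sym _ x); congr [|| _, _ | _].
  by apply: eq_has => p; apply: (@path_edgeC (discrete_graph T)).
have irr : irreflexive tri_adj.
  move=> x; rewrite /tri_adj !cyc_irrefl //=; apply/hasPn => p pps.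
  by rewrite /pth (@path_edge_irrefl (discrete_graph T)) ?Up.
exists (SGraph sym irr); first exact: card_ord.
exists c, a1, a2, b1, b2, ps; split; rewrite ?flatE //.
  by split; rewrite // -(size_map size) shapeE.
by rewrite shapeE.
Qed.

End Constructions.

(** * Recognizing the base graph *)

Section BaseSet.

Variables (G : sgraph) (K : {set G}) (r : G -> nat) (par : G -> G).
Hypothesis K_core : forall x, x \in K -> 2 <= #|nbrs x :&: K|.
Hypothesis par_adj : forall x, x \notin K -> adj x (par x).
Hypothesis par_lt : forall x, x \notin K -> r (par x) < r x.
Hypothesis par_unique : forall x y, x \notin K -> adj x y ->
  y = par x \/ (y \notin K /\ par y = x).

Let closed (S : {set G}) :=
  K \subset S /\ (forall x, x \in S -> x \notin K -> par x \in S).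

(** Vertices of [K] keep two neighbours in [K], and a vertex outside [K] with a child left in [S]
    still sees that child and its own parent; so only childless vertices outside [K] are deleted. *)
Let closed_delete S : closed S -> closed (delete_pendant S).
Proof.
move=> [KS S_par]; rewrite /delete_pendant; case: pickP => [v /andP[vS v1]|_] //.
have vK : v \notin K.
  apply: contraTN v1 => /K_core K2; rewrite gtn_eqF //.
  exact: leq_trans K2 (subset_leq_card (setIS _ KS)).
split=> [|x]; first by rewrite subsetD1 KS vK.
rewrite !in_setD1 => /andP[xv xS] xK; rewrite S_par // andbT.
apply: contraTneq v1 => parx; rewrite gtn_eqF //.
have vx : x != par v.
  by apply: contraTneq (par_lt xK) => E; rewrite parx -leqNgt E ltnW // par_lt.
apply: leq_trans (_ : #|[set x; par v]| <= _); first by rewrite cards2 vx.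
apply/subset_leq_card/subsetP => y; rewrite !inE => /orP[] /eqP->.
  by rewrite xS -parx adj_sym par_adj.
by rewrite par_adj // S_par.
Qed.

(** A vertex of [S] outside [K] of largest rank has no child in [S], hence its parent as only
    neighbour there: a pendant vertex exists until [K] is reached. *)
Let delete_lt S : closed S -> S != K -> #|delete_pendant S| < #|S|.
Proof.
move=> [KS S_par] SK; rewrite /delete_pendant; case: pickP => [v /andP[vS _]|no].
  by rewrite [leqRHS](cardsD1 v) vS.
have [x0 x0S x0K] : exists2 x, x \in S & x \notin K.
  by apply/subsetPn; apply: contra SK => SK; rewrite eqEsubset SK.
pose P x := (x \in S) && (x \notin K).
have Px0 : P x0 by rewrite /P x0S.
case: (arg_maxnP r Px0) => x /andP[xS xK] x_max.
have /negP[] : ~~ (#|nbrs x :&: S| == 1) by have := no x; rewrite xS /= => ->.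
suff -> : nbrs x :&: S = [set par x] by rewrite cards1.
apply/setP => y; rewrite !inE; apply/andP/eqP => [[xy yS]|->]; last first.
  by rewrite par_adj // S_par.
case: (par_unique xK xy) => // -[yK parE].
have := x_max y; rewrite /P yS yK => /(_ isT).
by rewrite /= leqNgt -parE par_lt.
Qed.

(** Each step before [K] is reached removes a vertex. If [#|G|] steps did not reach it, the set
    would be empty, and it still contains [K]. *)
Lemma base_set_core : base_set G = K.
Proof.
have iterP m : closed (iter m (@delete_pendant G) setT) /\
    (iter m (@delete_pendant G) setT = K \/
     #|iter m (@delete_pendant G) setT| + m <= #|G|).
  elim: m => [|m [IH1 IH2]] /=.
    split; last by right; rewrite addn0 max_card.
    by split=> [|x]; rewrite ?subsetT // !inE.
  split; first exact: closed_delete.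
  set S := iter m _ _ in IH1 IH2 *; have [SK|SK] := eqVneq S K.
    left; apply/eqP; rewrite eqEsubset; have [-> _] := closed_delete IH1.
    by rewrite andbT SK /delete_pendant; case: pickP => // v _; apply: subD1set.
  right; case: IH2 => [E|le]; first by rewrite E eqxx in SK.
  by rewrite addnS -addSn; apply: leq_trans le; rewrite leq_add2r delete_lt.
have [[KS _] []] := iterP #|G|; first by [].
move=> le; have S0 : base_set G = set0.
  by apply/eqP; rewrite -cards_eq0 -leqn0 -(leq_add2r #|G|) add0n.
by apply/eqP; rewrite eqEsubset KS andbT S0 sub0set.
Qed.

End BaseSet.

Lemma depth_exists (n : nat) (p : nat -> nat) :
    (forall i, 0 < i < n -> p i < i) ->
  exists2 h : nat -> nat, h 0 = 0 & forall i, 0 < i < n -> h i = (h (p i)).+1.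
Proof.
elim: n => [|n IHn] p_lt; first by exists id => // i; rewrite ltn0 andbF.
have [|h h0 hS] := IHn.
  by move=> i /andP[i0 lti]; apply: p_lt; rewrite i0 ltnW.
(* The guard [0 < n] keeps the root at depth 0 when the first index is added. *)
exists (fun i => if (i == n) && (0 < n) then (h (p n)).+1 else h i).
  by case: n {IHn p_lt hS}.
move=> i /andP[i0 lti]; have := p_lt i; rewrite i0 lti => /(_ isT) pi_lt.
have pin : p i == n = false.
  by apply/negbTE; rewrite neq_ltn (leq_trans pi_lt) // -ltnS.
rewrite pin /=; case: eqVneq => [E|ne]; first by rewrite -E i0.
by rewrite /= hS // i0 ltn_neqAle ne -ltnS.
Qed.

(** * A BFS-graph with prescribed degrees *)

Section BFSConstruction.

Variable pi : seq nat.
Let n := size pi.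
Let d i := nth 0 pi i.
Hypothesis pi_spec : bicyclic_spec pi.
Hypothesis last1 : last 0 pi = 1.
Hypothesis d1_ge3 : 3 <= d 1.

(* non_child i counts the neighbours of i that are not its BFS children: its parent
   and, on the edges 12 and 13 that close the triangles, the other endpoint. *)
Let non_child i := (0 < i) + 2 * (i == 1) + ((i == 2) || (i == 3)).
Let child i := d i - non_child i.
(** The parents of the vertices 1, 2, ... in this order: each vertex receives its children as one
    block, and the blocks follow the order of the vertices. *)
Let L := flatten [seq nseq (child j) j | j <- iota 0 n].
Let p i := nth 0 L i.-1.

Let d_mono i j : i <= j -> j < n -> d j <= d i.
Proof.
move=> ij jn; have := @sorted_leq_nth _ geq geq_trans leqnn 0 pi.
move=> /(_ (spec_sorted pi_spec) i j); rewrite !inE; apply => //.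
exact: leq_ltn_trans jn.
Qed.

Let d_pos i : i < n -> 0 < d i.
Proof. by move=> lti; apply: (allP (spec_pos pi_spec)); apply: mem_nth. Qed.

Let d_last : d n.-1 = 1.
Proof. by rewrite /d nth_last. Qed.

Let d3_ge2 : 2 <= d 3.
Proof.
rewrite leqNgt; apply/negP => d3; have := spec_ge4 pi_spec.
rewrite -(cat_take_drop 3 pi) count_cat.
have -> : count (fun d0 => 1 < d0) (drop 3 pi) = 0.
  apply/eqP; rewrite -leqn0 leqNgt -has_count; apply/hasPn => e.
  case/(nthP 0)=> i; rewrite size_drop ltn_subRL nth_drop => lti <-.
  rewrite -leqNgt; apply: leq_trans (_ : d 3 <= 1) => //.
  by apply: d_mono; rewrite ?leq_addr.
rewrite addn0 => /leq_trans/(_ (count_size _ _)); rewrite size_take.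
by case: (ltnP 3 (size pi)) => // le3 le4; have := leq_trans le4 le3.
Qed.

Let n_ge5 : 5 <= n.
Proof.
have n4 : 4 <= n by apply: leq_trans (spec_ge4 pi_spec) (count_size _ _).
rewrite ltn_neqAle n4 andbT; apply: contraTneq d3_ge2 => E.
by have := d_last; rewrite -E /= => ->.
Qed.

Let n_gt0 : 0 < n. Proof. exact: leq_trans n_ge5. Qed.

Let predn_n : n.-1.+1 = n. Proof. exact: prednK. Qed.

Let d0_ge3 : 3 <= d 0.
Proof. by apply: leq_trans d1_ge3 (d_mono _ _); rewrite // (leq_trans _ n_ge5). Qed.

Let non_child_le i : i < n -> non_child i <= d i.
Proof.
move=> lti; have d_gt0 := d_pos lti; rewrite /non_child.
case: i lti d_gt0 => [|[|[|[|i]]]] // lti _; apply: leq_trans d3_ge2 _.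
by apply: d_mono => //; apply: leq_trans n_ge5.
Qed.

Let S i := \sum_(0 <= j < i) child j.

Let sum_d : \sum_(0 <= j < n) d j = 2 * n.+1.
Proof. by rewrite -(spec_sum pi_spec) sumnE [RHS](big_nth 0). Qed.

Let S_total : S n = n.-1.
Proof.
(* [n - 1] parents, plus the edges 12 and 13 counted at both ends. *)
have sum_nc : \sum_(0 <= j < n) non_child j = n + 3.
  rewrite -(subnK n_ge5) addnC; elim: (n - 5) => [|k IHk].
    by rewrite addn0 unlock /=.
  by rewrite addnS big_nat_recr //= IHk /non_child /=; lia.
have : S n + \sum_(0 <= j < n) non_child j = 2 * n.+1.
  rewrite -sum_d -big_split; apply: eq_big_nat => j /andP[_ jn] /=.
  by rewrite subnK // non_child_le.
by rewrite sum_nc; move: (S n) n_ge5; lia.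
Qed.

Let S_tail i m k : i <= m -> (forall j, i <= j < m -> child j <= k) ->
  S m <= S i + (m - i) * k.
Proof.
move=> i_le ck; rewrite /S (big_cat_nat (leq0n i) i_le) leq_add2l.
rewrite -sum_nat_const_nat big_nat [leqRHS]big_nat.
by apply: leq_sum => j; apply: ck.
Qed.

Let child_ge4 j : 4 <= j -> child j = (d j).-1.
Proof. by case: j => [|[|[|[|j]]]] // _; rewrite /child /non_child /= subn1. Qed.

Let SS i : S i.+1 = S i + child i.
Proof. by rewrite /S big_nat_recr. Qed.

(** The vertices before [i] create at least [i] children, so the parent of [i] precedes [i]. The
    critical index is 4: [S 4 <= 3] forces the degrees 3, 3, 2, 2, and then at most one child per
    later vertex and none for the last give [S n <= n - 2]. Afterwards each vertex adds a child
    until the leaves begin, where [S] already has its final value [n - 1]. *)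
Let S_ge i : 0 < i < n -> i <= S i.
Proof.
have d0 := d0_ge3.
have d2 : 2 <= d 2 by apply: leq_trans d3_ge2 (d_mono _ _); rewrite // (leq_trans _ n_ge5).
have S1 : S 1 = d 0 by rewrite /S big_nat1 /child subn0.
have S2 : S 2 = S 1 + (d 1 - 3) := SS 1.
have S3 : S 3 = S 2 + (d 2 - 2) := SS 2.
have S4 : S 4 = S 3 + (d 3 - 2) := SS 3.
have S4_ge : 4 <= S 4.
  rewrite leqNgt; apply/negP => S4_lt.
  have d3E : d 3 <= 2.
    by move: S4_lt; rewrite S4 S3 S2 S1; move: (d 0) (d 1) (d 2) (d 3) d0 d1_ge3 d2; lia.
  have : S n.-1 <= S 4 + (n.-1 - 4) * 1.
    apply: S_tail => [|j /andP[j4 jn]]; first by rewrite -ltnS predn_n.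
    have jn' : j < n by apply: leq_trans jn (leq_pred _).
    by rewrite child_ge4 // -ltnS prednK ?d_pos // (leq_trans (d_mono (ltnW j4) jn')).
  have : S n = S n.-1.
    by rewrite -{1}predn_n SS child_ge4 ?d_last ?addn0 // -ltnS predn_n.
  move=> <-; rewrite S_total muln1; move: (S 4) n n_ge5 S4_lt; lia.
case: i => [|[|[|[|i]]]] // lti.
- by rewrite S1 (leq_trans _ d0).
- by rewrite S2 S1 (leq_trans (leq_trans _ d0)) // leq_addr.
- by rewrite S3 S2 S1 -addnA (leq_trans d0) // leq_addr.
elim: i lti => [|i IHi] // /andP[_ lti].
have i_lt : i.+4 < n by apply: ltnW.
have {}IHi : i.+4 <= S i.+4 by apply: IHi.
have [di|di] := leqP (d i.+4) 1.
  apply: leq_trans (_ : S n <= _); first by rewrite S_total -ltnS predn_n.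
  apply: leq_trans (@S_tail i.+4.+1 n 0 (ltnW lti) _) _; last by rewrite muln0 addn0.
  move=> j /andP[ij jn]; rewrite child_ge4; last exact: leq_trans ij.
  by rewrite -ltnS prednK ?d_pos // (leq_trans (d_mono (ltnW ij) jn)).
rewrite SS child_ge4 // -addn1; apply: leq_add => //.
by rewrite -ltnS prednK // ltnW.
Qed.

Let L_size : size L = n.-1.
Proof.
rewrite size_flatten /shape -map_comp sumnE big_map -S_total /S /index_iota subn0.
by apply: eq_bigr => j _; rewrite /= size_nseq.
Qed.

Let L_count i : i < n -> count_mem i L = child i.
Proof.
move=> lti; rewrite count_flatten -map_comp sumnE big_map.
rewrite (bigD1_seq i) ?iota_uniq ?mem_iota //= count_nseq /= eqxx mul1n.
by rewrite big1 ?addn0 // => j ji; rewrite count_nseq /= (negPf ji).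
Qed.

Let L_split i : i <= n -> L = flatten [seq nseq (child j) j | j <- iota 0 i]
   ++ flatten [seq nseq (child j) j | j <- iota i (n - i)].
Proof. by move=> i_le; rewrite -flatten_cat -map_cat -iotaD subnKC. Qed.

Let L_sorted : sorted leq L.
Proof.
rewrite /L; elim: n 0 => [|m IHm] k //=.
rewrite (sorted_pairwise leq_trans) pairwise_cat -!(sorted_pairwise leq_trans) IHm.
rewrite andbT; apply/andP; split.
  apply/allrelP => x y; rewrite mem_nseq => /andP[_ /eqP->].
  case/flattenP=> q /mapP[j]; rewrite mem_iota => /andP[kj _] ->.
  by rewrite mem_nseq => /andP[_ /eqP->]; apply: ltnW.
by elim: (child k) => [|[|c] IHc] //=; rewrite leqnn.
Qed.

Let p_lt i : 0 < i < n -> p i < i.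
Proof.
move=> /andP[i0 lti]; rewrite /p (L_split (ltnW lti)) nth_cat.
set F := flatten _; have szF : size F = S i.
  rewrite size_flatten /shape -map_comp sumnE big_map /S /index_iota subn0.
  by apply: eq_bigr => j _; rewrite /= size_nseq.
have ltF : i.-1 < size F by rewrite szF prednK // S_ge ?i0.
rewrite ltF; have := mem_nth 0 ltF; case/flattenP=> q /mapP[j + ->].
by rewrite mem_iota mem_nseq => /andP[_ ji] /andP[_ /eqP->].
Qed.

Let p_mono i j : i <= j -> j < n -> p i <= p j.
Proof.
move=> ij jn; have [j0|j0] := posnP j.
  by move: ij; rewrite j0 leqn0 => /eqP->.
have lt_j : j.-1 < n.-1 by rewrite -ltnS prednK // predn_n.
have le_ij : i.-1 <= j.-1 by rewrite -!subn1 leq_sub2r.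
apply: (@sorted_leq_nth _ leq leq_trans leqnn 0 L L_sorted) => //.
  by rewrite inE L_size (leq_ltn_trans le_ij).
by rewrite inE L_size.
Qed.

Let p_small i : 0 < i < 4 -> p i = 0.
Proof.
move=> /andP[i0 i4]; rewrite /p (L_split n_gt0) /= cats0 nth_cat size_nseq.
have -> : i.-1 < child 0.
  by rewrite /child subn0 prednK // (leq_trans _ d0_ge3).
by rewrite nth_nseq; case: ifP.
Qed.

Let par_edge i j := (0 < i) && (p i == j).
Let tri_edge i j := (i == 1) && ((j == 2) || (j == 3)).
Let bfs_adj : rel 'I_n := fun x y =>
  [|| par_edge x y, par_edge y x, tri_edge x y | tri_edge y x].

Let par_edge_lt i j : i < n -> par_edge i j -> j < i.
Proof. by move=> lti /andP[i0 /eqP<-]; apply: p_lt; rewrite i0. Qed.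

Let par_edge_tri i j : par_edge i j -> tri_edge i j || tri_edge j i = false.
Proof.
case/andP=> i0 /eqP pij; apply/negP => /orP[] /andP[/eqP E1 E2].
  by move: E2; rewrite -pij E1 p_small.
by move: pij; rewrite E1 p_small //; case/orP: E2 => /eqP->.
Qed.

Let tri_edge_lt i j : tri_edge i j -> i < j.
Proof. by case/andP=> /eqP-> /orP[] /eqP->. Qed.

Let bfs_sym : symmetric bfs_adj.
Proof.
move=> x y; rewrite /bfs_adj orbA [par_edge x y || _]orbC -orbA.
by rewrite [tri_edge x y || _]orbC.
Qed.

Let bfs_irrefl : irreflexive bfs_adj.
Proof.
move=> x; rewrite /bfs_adj; apply/negP => /or4P[] H.
- by have := par_edge_lt (ltn_ord x) H; rewrite ltnn.
- by have := par_edge_lt (ltn_ord x) H; rewrite ltnn.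
- by have := tri_edge_lt H; rewrite ltnn.
- by have := tri_edge_lt H; rewrite ltnn.
Qed.

(** Parents precede their children, and 12 and 13 are no parent edges because 1, 2, 3 are children
    of 0. The four kinds of adjacency thus exclude one another, and degrees can be computed kind by
    kind. *)
Let bfs_adj_sum (x y : 'I_n) : bfs_adj x y =
  par_edge x y + par_edge y x + tri_edge x y + tri_edge y x :> nat.
Proof.
rewrite /bfs_adj; case xy: (par_edge x y).
  have := par_edge_tri xy; case: (tri_edge x y) => //=; case: (tri_edge y x) => // _.
  case yx: (par_edge y x) => //; have := par_edge_lt (ltn_ord _) xy.
  by rewrite ltnNge ltnW // (par_edge_lt (ltn_ord _) yx).
case yx: (par_edge y x) => /=.
  by have := par_edge_tri yx; case: (tri_edge x y); case: (tri_edge y x).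
case txy: (tri_edge x y) => //; case tyx: (tri_edge y x) => //.
by have := tri_edge_lt txy; rewrite ltnNge ltnW // (tri_edge_lt tyx).
Qed.

Let G := SGraph bfs_sym bfs_irrefl.

Let sum_delta m : m < n -> \sum_(y < n) (y == m :> nat) = 1.
Proof.
move=> ltm; rewrite (bigD1 (Ordinal ltm)) //= eqxx big1 // => y.
by rewrite -val_eqE /= => /negPf->.
Qed.

Let sum_children i : i < n -> \sum_(y < n) par_edge y i = child i.
Proof.
move=> lti; rewrite -L_count // -(big_mkord predT (fun y => par_edge y i : nat)).
rewrite -predn_n big_nat_recl //= add0n -sum1_count [RHS]big_mkcond [RHS](big_nth 0) L_size.
by apply: eq_bigr => y _; rewrite /par_edge /p /=; case: (_ == _).
Qed.

Let deg_bfs (x : G) : deg x = d x.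
Proof.
have ltx : x < n := ltn_ord x.
have -> : deg x = \sum_(y < n) bfs_adj x y.
  rewrite /deg -sum1_card big_mkcond; apply: eq_bigr => y _.
  by rewrite inE -[adj x y]/(bfs_adj x y); case: bfs_adj.
under eq_bigr do rewrite bfs_adj_sum.
rewrite !big_split /= sum_children //.
have -> : \sum_(y < n) par_edge x y = (0 < x).
  rewrite /par_edge; case: (posnP x) => x0 /=; first by rewrite big1.
  rewrite -[RHS](sum_delta (ltn_trans (p_lt (introT andP (conj x0 ltx))) ltx)).
  by apply: eq_bigr => y _; rewrite eq_sym.
have lt_n m : m < 4 -> m < n by move=> /leq_trans; apply; apply: ltnW.
have -> : \sum_(y < n) tri_edge x y = 2 * (x == 1 :> nat).
  rewrite /tri_edge; case: (x == 1 :> nat) => /=; last by rewrite big1.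
  rewrite -[RHS](congr2 addn (sum_delta (lt_n 2 isT)) (sum_delta (lt_n 3 isT))).
  by rewrite -big_split; apply: eq_bigr => y _ /=; case: eqP => [->|].
have -> : \sum_(y < n) tri_edge y x = (x == 2 :> nat) || (x == 3 :> nat).
  rewrite /tri_edge; case: (_ || _) => /=; last by rewrite big1 // => y; rewrite andbF.
  by under eq_bigr do rewrite andbT; rewrite sum_delta ?lt_n.
have := non_child_le ltx; rewrite /child /non_child => le.
by rewrite -[RHS](subnK le) [_ + (d x - _)]addnC -!addnA.
Qed.

Let deg_enum : [seq deg v | v <- enum G] = pi.
Proof.
have -> : [seq deg v | v <- enum G] = map d (map val (enum 'I_n)).
  by rewrite -map_comp; apply: eq_map => x; apply: deg_bfs.
by rewrite val_enum_ord -/(mkseq d n) mkseq_nth.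
Qed.

Let bfs_degree_seq : degree_seq G = pi.
Proof.
apply: (@degree_seq_perm G (enum 'I_n)) (enum_uniq _) (mem_enum _) (spec_sorted pi_spec) _.
by rewrite deg_enum.
Qed.

Let small_adj (x y : G) : x < 4 -> y < 4 ->
  adj x y = (x != y :> nat) && (minn x y < 2).
Proof.
move=> x4 y4; rewrite -[adj x y]/(bfs_adj x y) /bfs_adj /par_edge /tri_edge.
have := p_small; move: (x : nat) (y : nat) x4 y4 => i j i4 j4 ps.
have -> : (0 < i) && (p i == j) = (0 < i) && (j == 0).
  by case: (posnP i) => //= i0; rewrite ps ?i0 // eq_sym.
have -> : (0 < j) && (p j == i) = (0 < j) && (i == 0).
  by case: (posnP j) => //= j0; rewrite ps ?j0 // eq_sym.
by case: i i4 => [|[|[|[|i]]]] // _; case: j j4 => [|[|[|[|j]]]].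
Qed.

Let lt_n k : k < 4 -> k < n.
Proof. by move=> /leq_trans; apply; apply: ltnW. Qed.

Let v1 : G := Ordinal (@lt_n 0 isT).
Let v2 : G := Ordinal (@lt_n 1 isT).
Let v3 : G := Ordinal (@lt_n 2 isT).
Let v4 : G := Ordinal (@lt_n 3 isT).
Let K : {set G} := [set v1; v2; v3; v4].

Let K_mem (x : G) : (x \in K) = (x < 4).
Proof.
by rewrite !inE -!val_eqE /=; case: (nat_of_ord x) => [|[|[|[|i]]]].
Qed.

Let base_K : base_set G = K.
Proof.
(* Outside [K], [p x < x < n], so the default [v1] is never taken. *)
have par_val (x : G) : x \notin K -> val (insubd v1 (p x) : G) = p x.
  rewrite K_mem -leqNgt => x4; rewrite val_insubd ifT //.
  apply: ltn_trans (ltn_ord x); apply: p_lt; rewrite ltn_ord andbT.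
  exact: leq_trans x4.
have pos (x : G) : x \notin K -> 0 < x < n.
  by rewrite K_mem -leqNgt ltn_ord andbT; apply: leq_trans.
apply: (@base_set_core G K (@nat_of_ord n) (fun x : G => insubd v1 (p x) : G)).
- move=> x xK; have two (y z : G) : y < 4 -> z < 4 -> y != z -> adj x y -> adj x z ->
      2 <= #|nbrs x :&: K|.
    move=> y4 z4 yz xy xz; apply: leq_trans (_ : #|[set y; z]| <= _).
      by rewrite cards2 yz.
    apply/subset_leq_card/subsetP => u; rewrite in_setI in_set2 => /orP[] /eqP->.
      by rewrite K_mem y4 inE xy.
    by rewrite K_mem z4 inE xz.
  rewrite K_mem in xK; case: (posnP x) => x0.
    by apply: (two v2 v3); rewrite // small_adj // x0.
  have [x1|x1] := leqP x 1.
    have xE : x = 1 :> nat by apply/eqP; rewrite eqn_leq x1.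
    by apply: (two v1 v3); rewrite // small_adj // xE.
  by apply: (two v1 v2); rewrite // small_adj //=;
    move: (nat_of_ord x) x1 => [|[|i]].
- move=> x xK; rewrite -[adj _ _]/(bfs_adj _ _) /bfs_adj /par_edge par_val //.
  by rewrite eqxx; case/andP: (pos x xK) => ->.
- by move=> x xK; rewrite par_val // p_lt // pos.
move=> x y xK; have x4 : 4 <= x by rewrite leqNgt -K_mem.
have notri : (tri_edge x y = false) * (tri_edge y x = false).
  by rewrite /tri_edge; move: (nat_of_ord x) x4 => [|[|[|[|i]]]] //= _; rewrite andbF.
rewrite -[adj _ _]/(bfs_adj _ _) /bfs_adj !notri !orbF.
case/orP=> xy; [left | right].
  by apply: val_inj; rewrite par_val //; case/andP: xy => _ /eqP->.
have yK : y \notin K.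
  by rewrite K_mem -leqNgt (leq_trans x4) // ltnW // par_edge_lt.
by split=> //; apply: val_inj; rewrite par_val //; case/andP: xy => _ /eqP->.
Qed.

Let base_iso : isomorphic (base_graph G) K4e.
Proof.
have small (x : base_graph G) : val (val x) < 4.
  by rewrite -K_mem -base_K; apply: valP.
pose phi (x : base_graph G) : K4e := Ordinal (small x).
exists phi; last first.
  move=> x y; rewrite -[RHS]/(adj (val x) (val y)) (small_adj (small x) (small y)).
  by rewrite -[LHS]/(K4e_adj (phi x) (phi y)) /K4e_adj -val_eqE.
apply: inj_card_bij; first by move=> x y [E]; apply/val_inj/val_inj.
rewrite card_ord card_sig.
have U4 : uniq [:: v1; v2; v3; v4] by [].
rewrite -[4]/(size [:: v1; v2; v3; v4]) -(card_uniqP U4).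
apply/subset_leq_card/subsetP => x xv; suff : x \in base_set G by [].
rewrite base_K K_mem; move: xv; rewrite !inE -!val_eqE /=.
by case: (nat_of_ord x) => [|[|[|[|i]]]].
Qed.

Lemma BFS_on_K4e_exists : exists2 H : sgraph, Gamma pi H & BFS_graph_on_K4e H.
Proof.
have [h h0 hS] := depth_exists p_lt.
have h_mono i j : i <= j -> j < n -> h i <= h j.
  elim/ltn_ind: j i => j IHj i ij jn; have [->|i0] := posnP i; first by rewrite h0.
  have j0 := leq_trans i0 ij.
  rewrite (hS i) ?i0 ?(leq_ltn_trans ij) // (hS j) ?j0 // ltnS.
  have pj : p j < j by rewrite p_lt // j0.
  by apply: IHj; rewrite ?p_mono // (ltn_trans pj).
have h_small i : 0 < i < 4 -> h i = 1.
  by move=> i4; case/andP: (i4) => i0 /lt_n i_n; rewrite hS ?i0 // p_small // h0.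
have h_tri i j : tri_edge i j -> h i = 1 /\ h j = 1.
  by case/andP=> /eqP-> /orP[] /eqP->; rewrite !h_small.
have h_par (x y : 'I_n) : par_edge x y -> h x = (h y).+1.
  by case/andP=> x0 /eqP<-; rewrite -hS // x0 ltn_ord.
(* Depth along parents is the distance to [v1], since the extra edges 12 and 13 join vertices of
   depth 1. *)
have distE (x : G) : dist v1 x = h x /\ connect adj v1 x.
  apply: (@dist_unique G (fun y => h (val y))); first exact: h0.
    move=> u w; case/or4P=> [/h_par->|/h_par->|/h_tri[-> ->]|/h_tri[-> ->]] //.
    exact: leqW.
  move=> u; rewrite -val_eqE /= -lt0n => u0.
  have pu : p u < u by rewrite p_lt // u0 ltn_ord.
  exists (Ordinal (ltn_trans pu (ltn_ord u))); last by rewrite -hS // u0 ltn_ord.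
  by apply/or4P/Or41; rewrite /par_edge u0 eqxx.
have cG : connected G by apply: (@connected_from _ v1) => x; case: (distE x).
exists G; first by split; rewrite ?bfs_degree_seq.
pose s := drop 4 (enum G).
have enumE : enum G = [:: v1, v2, v3, v4 & s].
  rewrite -[LHS](cat_take_drop 4) -[RHS]/([:: v1; v2; v3; v4] ++ s); congr (_ ++ _).
  apply: (inj_map val_inj); rewrite map_take val_enum_ord take_iota.
  by rewrite (minn_idPl _) // ltnW.
have idxE (x : G) : index x [:: v1, v2, v3, v4 & s] = x.
  by rewrite -enumE; apply: index_enum_ord.
have bfs : BFS_ordering v1 [:: v2, v3, v4 & s].
  split; rewrite -?enumE.
  - by split; [exact: enum_uniq | move=> x; rewrite mem_enum].
  - by have := spec_sorted pi_spec; rewrite -{1}deg_enum sorted_map.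
  - apply: (@sub_sorted _ (relpre val ltn)) => [x y /= xy|].
      by rewrite !(fst (distE _)) h_mono // ltnW.
    by rewrite -sorted_map val_enum_ord iota_ltn_sorted.
  move=> u w v z; rewrite !inE => /andP[_ uv] /andP[_ wz].
  have hE := fun x => fst (distE x); rewrite !hE => huw hv hz.
  rewrite enumE !idxE => lt_uw.
  (* A neighbour one level deeper is neither the parent, which is one level higher, nor joined by 12
     or 13, which stay on one level. *)
  have child_of (x y : G) : adj x y -> h y = (h x).+1 -> p y = x.
    case/or4P=> [/h_par E|/andP[_ /eqP]//|/h_tri[-> ->]|/h_tri[-> ->]] // E'.
    by move: E'; rewrite E => /eqP; rewrite -addn2 -[X in X == _]addn0 eqn_add2l.
  have pv := child_of _ _ uv hv; have pz : p z = w by apply: child_of wz _; rewrite -huw.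
  (* The BFS condition is the contrapositive of the monotonicity of [p]. *)
  rewrite ltnNge; apply: contraL lt_uw => zv; rewrite -leqNgt -pv -pz.
  by apply: p_mono.
split; [by exists v1, [:: v2, v3, v4 & s] | exact: base_iso |].
by exists v1, v2, v3, v4, s; split=> //; rewrite small_adj.
Qed.

End BFSConstruction.

(** * The four cases together *)

Lemma two_triangles_spec pi (G : sgraph) : bicyclic_spec pi ->
    5 <= nth 0 pi 0 -> nth 0 pi 1 = 2 -> last 0 pi = 1 -> #|G| = size pi ->
    two_triangles_with_paths G (nth 0 pi 0 - 4) ->
  Gamma pi G /\ tight G.
Proof.
move=> pi_spec d1 d2 dn sizeG [c [a1 [a2 [b1 [b2 [ps [U o_mem [szps ps_nil] ael adjE]]]]]]].
have [so sumE pos _ _] := pi_spec.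
have GG : Gamma pi G.
  split; first exact: (two_triangles_connected U o_mem adjE).
  clear pi_spec; case: pi d1 d2 dn sizeG szps so sumE pos => [|d ds] //=.
  move=> d1 d2 dn sizeG szps.
  move=> so sumE /andP[_ pos].
  have dE : d = 4 + size ps by rewrite szps; lia.
  rewrite dE; apply: (two_triangles_degree_seq U) => //.
  - by rewrite -dE.
  - case: ds d2 so pos {dn sizeG sumE} => [|d' ds] //= -> /andP[_ so] pos.
    have le2 := order_path_min geq_trans so; case/andP: pos => _ pos /=.
    by apply/allP => e eds; rewrite (allP pos) //=; apply: (allP le2).
  - by rewrite sizeG.
  - lia.
split=> //; apply: (two_triangles_tight U o_mem ps_nil ael adjE).
exact: Gamma_sum_deg pi_spec GG.
Qed.

Lemma is_BM_spec pi (G : sgraph) : bicyclic_spec pi -> is_BM pi G ->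
  Gamma pi G /\ tight G.
Proof.
move=> pi_spec.
case=> [[dn d12 GG bfs]|[d1 d2 dn sizeG tri]|[piE sizeG cyc]|[piE sizeG cyc]].
- split=> //; apply: BFS_on_K4e_tight bfs; first by case: GG.
  exact: Gamma_sum_deg pi_spec GG.
- exact: two_triangles_spec pi_spec d1 d2 dn sizeG tri.
- have [cG degE tG] := two_cycles_vertex_spec cyc.
  by split=> //; split=> //; rewrite degE sizeG -piE.
- have [cG degE tG] := triangle_cycle_spec cyc.
  by split=> //; split=> //; rewrite degE sizeG -piE.
Qed.

Lemma is_BM_exists pi : bicyclic_spec pi -> exists G : sgraph, is_BM pi G.
Proof.
move=> pi_spec; case: (bicyclic_exhaust pi_spec).
- move=> dn d12; case/andP: (d12) => d2_ge3 _.
  have [G GG bfs] := BFS_on_K4e_exists pi_spec dn d2_ge3.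
  by exists G; apply: Or41.
- move=> d ds piE d0 ds12 d2 dn.
  have [_ sumE _ _ ge5] := pi_spec.
  have ds_le2 : count (fun e => 2 < e) ds = 0.
    apply/eqP; rewrite -leqn0 leqNgt -has_count; apply/hasPn => e /(allP ds12).
    by rewrite -leqNgt => /andP[].
  (* By the degree sum, [ds] has [d] more entries than twos, and [spec_ge5] provides at least four
     twos. *)
  have big : d + 5 <= size pi.
    move: ge5 sumE; rewrite piE /= ds_le2 (sumn_12 ds12) => /(_ isT); lia.
  have [G sizeG tri] := two_triangles_exists d0 big.
  have d1E : nth 0 pi 0 = d.+4 by rewrite piE.
  by exists G; apply: Or42; split; rewrite ?d1E // -[d.+4]addn4 addnK.
- move=> piE; have [_ _ _ _ ge5] := pi_spec.
  have big : 5 <= size pi.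
    apply: leq_trans (count_size (fun e => 1 < e) _); apply: ge5.
    by rewrite piE /= count_nseq.
  by have [G sizeG cyc] := two_cycles_exists big; exists G; apply: Or43.
- move=> piE; have [_ _ _ ge4 _] := pi_spec.
  have big : 4 <= size pi by apply: leq_trans ge4 (count_size _ _).
  by have [G sizeG cyc] := triangle_cycle_exists big; exists G; apply: Or44.
Qed.

Theorem theorem4 (R : realType) (f : R -> R -> R)
    (f_sym : symmetric_on_pos f)
    (f_esc : escalating f \/ deescalating f)
    (pi : seq nat) (pi_bicyclic : bicyclic_degree_seq pi) :
  (exists G : sgraph, is_BM pi G) /\
  (forall G : sgraph, is_BM pi G -> extremal f (Gamma pi) G).
Proof.
have pi_spec := bicyclic_degree_seqP pi_bicyclic; split; first exact: is_BM_exists.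
move=> G /(is_BM_spec pi_spec)[GG tG]; apply: extremal_dominates => // H HH.
have [[_ degG] [cH degH]] := (GG, HH).
by apply: tight_dominates; rewrite ?degG ?degH //; apply: Gamma_sum_deg pi_spec HH.
Qed.
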